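(* Let $(P,B,\Phi)$ be a trivial braided principal bundle with base $M=P^B$. Then strong connections $\omega:B\to\Omega^1P$ are in 1-1 correspondence with morphisms $A:B\to\Omega^1M$ such that $A\circ\eta=0$, via $$\omega=\Phi^{-1}*d\Phi+\Phi^{-1}*A*\Phi,\qquad A=\Phi*\omega*\Phi^{-1}-(d\Phi)*\Phi^{-1},$$ where $d\Phi=d\circ\Phi$.
   Context: Work in a (strict) braided monoidal abelian category with unit object $\underline 1$ and braiding $\Psi_{V,W}:V\otimes W\to W\otimes V$ (not assumed symmetric), whose tensor product is additive and compatible with (preserves) equalisers and coequalisers. Algebras, coalgebras, modules and comodules are internal to this category, and inclusions of subobjects are suppressed. For algebras $X,Y$ the braided tensor product algebra $X\underline\otimes Y$ is $X\otimes Y$ with product $(\cdot_X\otimes\cdot_Y)\circ(\mathrm{id}\otimes\Psi_{Y,X}\otimes\mathrm{id})$. A braided group $B$ is an algebra $(B,\cdot,\eta)$ and coalgebra $(B,\Delta,\epsilon)$ with $\Delta:B\to B\underline\otimes B$ and $\epsilon$ algebra morphisms, and an antipode $S:B\to B$ (convolution inverse of $\mathrm{id}$). A braided right $B$-comodule algebra is an algebra $P$ with a right coaction $\rho:P\to P\otimes B$ that is an algebra morphism $P\to P\underline\otimes B$. The tensor product coaction on $V\otimes W$ is $(\mathrm{id}\otimes\mathrm{id}\otimes\cdot)\circ(\mathrm{id}\otimes\Psi_{B,W}\otimes\mathrm{id})\circ(\rho_V\otimes\rho_W)$. A trivial braided principal bundle $(P,B,\Phi)$ consists of a braided right $B$-comodule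 algebra $P$ with coaction $\rho$, with $M=P^B$ (the equaliser of $\rho$ and $\mathrm{id}\otimes\eta:P\to P\otimes B$, a subalgebra) and $P$ flat as an $M$-module, and a morphism $\Phi:B\to P$ with $\rho\circ\Phi=(\Phi\otimes\mathrm{id})\circ\Delta$, $\Phi\circ\eta=\eta_P$, having a convolution inverse $\Phi^{-1}:B\to P$. (Then the morphism $\chi:P\otimes_MP\to P\otimes B$ induced by $\tilde\chi=(\cdot_P\otimes\mathrm{id})\circ(\mathrm{id}\otimes\rho)$ is invertible.) Universal 1-forms: $\Omega^1P=\ker(\cdot_P:P\otimes P\to P)$, a $P$-bimodule by outer multiplication, with $d=\eta_P\otimes\mathrm{id}-\mathrm{id}\otimes\eta_P:P\to\Omega^1P$; likewise $\Omega^1M\subset\Omega^1P$. $(\Omega^1M)P$ is the image of $\Omega^1M\otimes P$ in $\Omega^1P$ under right multiplication. $B$ coacts on $\Omega^1P\subset P\otimes P$ by the tensor product coaction. Convolution $f*g=\mathrm{mult}\circ(f\otimes g)\circ\Delta$ is used whenever $f,g$ are morphisms from $B$ into $P$ or $\Omega^1P$ (at most one into $\Omega^1P$), with mult the product or the bimodule action. The braided adjoint coaction is $\mathrm{Ad}=(\mathrm{id}\otimes\cdot)\circ(\Psi_{B,B}\otimes\mathrm{id})\circ(S\otimes\Delta)\circ\Delta:B\to B\otimes B$. A connection on $P$ is a morphism $\omega:B\to\Omega^1P$ such that (C1) $\tilde\chi\circ\omega=\eta_P\otimes(\mathrm{id}-\eta\circ\epsilon)$ and $\omega\circ\eta=0$;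 (C2) $\rho_{\Omega^1P}\circ\omega=(\omega\otimes\mathrm{id})\circ\mathrm{Ad}$. Its associated projection is $\Pi=\cdot_L\circ(\mathrm{id}\otimes\omega)\circ\tilde\chi|_{\Omega^1P}:\Omega^1P\to\Omega^1P$, with $\cdot_L$ the left action of $P$ on $\Omega^1P$. The connection is strong if (C3) $(\mathrm{id}-\Pi)\circ d:P\to\Omega^1P$ factors through $(\Omega^1M)P$. *)

(* Defs.v *)
From Stdlib Require Import ClassicalEpsilon.

Set Implicit Arguments.
Unset Strict Implicit.
Unset Printing Implicit Defensive.

(** * Strict braided monoidal abelian categories

    Strictness means (X ⊗ Y) ⊗ Z = X ⊗ (Y ⊗ Z) and 1 ⊗ X = X = X ⊗ 1 on the
    nose.  With hom-types indexed by objects these equalities would force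
    transports into every formula, so all morphisms live in one type [Mor],
    with domain and codomain functions, and "f : X -> Y" is the predicate
    [Hom X Y f].  [comp], [addm] are total functions, but the axioms below
    constrain them only on composable, respectively parallel, morphisms. *)

Record cat_data : Type := CatData {
  Ob : Type;
  Mor : Type;
  dom : Mor -> Ob;
  cod : Mor -> Ob;
  idm : Ob -> Mor;
  comp : Mor -> Mor -> Mor;
  zerom : Ob -> Ob -> Mor;
  addm : Mor -> Mor -> Mor;
  oppm : Mor -> Mor;
  unitO : Ob;
  tensO : Ob -> Ob -> Ob;
  tensm : Mor -> Mor -> Mor;
  braid : Ob -> Ob -> Mor
}.

Arguments unitO {c}.

Declare Scope ob_scope.
Declare Scope mor_scope.
Delimit Scope ob_scope with ob.
Delimit Scope mor_scope with mor.
Bind Scope ob_scope with Ob.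
Bind Scope mor_scope with Mor.
Arguments idm {c} X%_ob : rename.
Arguments zerom {c} X%_ob Y%_ob : rename.
Arguments braid {c} X%_ob Y%_ob : rename.
Arguments dom {c} f%_mor : rename.
Arguments cod {c} f%_mor : rename.

Notation "X ⊗ Y" := (tensO X Y) (at level 40, left associativity) : ob_scope.
Notation "f ⊗ g" := (tensm f g) (at level 40, left associativity) : mor_scope.
Notation "g ∘ f" := (comp g f) (at level 40, left associativity) : mor_scope.
Notation "f + g" := (addm f g) : mor_scope.
Notation "- f" := (oppm f) : mor_scope.
Notation "f - g" := (addm f (oppm g)) : mor_scope.

Local Open Scope mor_scope.

Definition Hom (C : cat_data) (X Y : Ob C) (f : Mor C) : Prop :=
  dom f = X /\ cod f = Y.

Record is_category (C : cat_data) : Prop := {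
  hom_id : forall X : Ob C, Hom X X (idm X);
  hom_comp : forall (X Y Z : Ob C) f g,
    Hom X Y f -> Hom Y Z g -> Hom X Z (g ∘ f);
  comp_assoc : forall f g h : Mor C,
    cod f = dom g -> cod g = dom h -> h ∘ (g ∘ f) = h ∘ g ∘ f;
  comp_idr : forall f : Mor C, f ∘ idm (dom f) = f;
  comp_idl : forall f : Mor C, idm (cod f) ∘ f = f
}.

Record is_preadditive (C : cat_data) : Prop := {
  hom_zero : forall X Y : Ob C, Hom X Y (zerom X Y);
  hom_add : forall (X Y : Ob C) f g,
    Hom X Y f -> Hom X Y g -> Hom X Y (f + g);
  hom_opp : forall (X Y : Ob C) f, Hom X Y f -> Hom X Y (- f);
  add_assoc : forall (X Y : Ob C) f g h,
    Hom X Y f -> Hom X Y g -> Hom X Y h -> f + (g + h) = f + g + h;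
  add_comm : forall (X Y : Ob C) f g,
    Hom X Y f -> Hom X Y g -> f + g = g + f;
  add_zero : forall (X Y : Ob C) f, Hom X Y f -> f + zerom X Y = f;
  add_opp : forall (X Y : Ob C) f, Hom X Y f -> f - f = zerom X Y;
  comp_addl : forall (X Y Z : Ob C) f g h,
    Hom X Y f -> Hom Y Z g -> Hom Y Z h -> (g + h) ∘ f = g ∘ f + h ∘ f;
  comp_addr : forall (X Y Z : Ob C) f g h,
    Hom X Y f -> Hom X Y g -> Hom Y Z h -> h ∘ (f + g) = h ∘ f + h ∘ g
}.

Section Limits.
Variable C : cat_data.
Implicit Types (e f g h m j c : Mor C) (X Y Z : Ob C).

Definition mono m : Prop :=
  forall X f g, Hom X (dom m) f -> Hom X (dom m) g -> m ∘ f = m ∘ g -> f = g.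

Definition epi c : Prop :=
  forall X f g, Hom (cod c) X f -> Hom (cod c) X g -> f ∘ c = g ∘ c -> f = g.

Definition parallel f g : Prop := dom f = dom g /\ cod f = cod g.

Record is_equaliser e f g : Prop := {
  eq_parallel : parallel f g;
  eq_cod : cod e = dom f;
  eq_comm : f ∘ e = g ∘ e;
  eq_univ : forall h, cod h = dom f -> f ∘ h = g ∘ h ->
    exists! u, Hom (dom h) (dom e) u /\ e ∘ u = h
}.

Record is_coequaliser c f g : Prop := {
  coeq_parallel : parallel f g;
  coeq_dom : dom c = cod f;
  coeq_comm : c ∘ f = c ∘ g;
  coeq_univ : forall h, dom h = cod f -> h ∘ f = h ∘ g ->
    exists! u, Hom (cod c) (cod h) u /\ u ∘ c = h
}.

Definition is_kernel j f : Prop := is_equaliser j f (zerom (dom f) (cod f)).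
Definition is_cokernel c f : Prop := is_coequaliser c f (zerom (dom f) (cod f)).

(** im f = ker (coker f) *)
Definition is_image m f : Prop :=
  exists c, is_cokernel c f /\ is_kernel m c.

Definition factors_through_image f g : Prop :=
  exists m u, is_image m g /\ Hom (dom f) (dom m) u /\ m ∘ u = f.

(** The morphism [u : dom f -> dom e] with [e ∘ u = f].  It is used only with
    [e] a monomorphism through which [f] factors, so that [u] exists and is
    unique. *)
Definition factor e f : Mor C :=
  epsilon (inhabits f) (fun u => Hom (dom f) (dom e) u /\ e ∘ u = f).

End Limits.

Record is_abelian (C : cat_data) : Prop := {
  ab_category : is_category C;
  ab_preadditive : is_preadditive C;
  ab_zero_object : exists Z : Ob C, forall X : Ob C,
    (exists! f, Hom X Z f) /\ (exists! f, Hom Z X f);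
  ab_biproduct : forall X Y : Ob C, exists (S : Ob C) (i1 i2 p1 p2 : Mor C),
    (Hom X S i1 /\ Hom Y S i2 /\ Hom S X p1 /\ Hom S Y p2) /\
    (p1 ∘ i1 = idm X /\ p2 ∘ i2 = idm Y /\
     p2 ∘ i1 = zerom X Y /\ p1 ∘ i2 = zerom Y X /\
     i1 ∘ p1 + i2 ∘ p2 = idm S);
  ab_kernel : forall f : Mor C, exists j, is_kernel j f;
  ab_cokernel : forall f : Mor C, exists c, is_cokernel c f;
  ab_mono : forall m : Mor C, mono m -> exists f, is_kernel m f;
  ab_epi : forall c : Mor C, epi c -> exists f, is_cokernel c f
}.

Record is_strict_monoidal (C : cat_data) : Prop := {
  hom_tens : forall (X Y X' Y' : Ob C) f g,
    Hom X Y f -> Hom X' Y' g -> Hom (X ⊗ X') (Y ⊗ Y') (f ⊗ g);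
  tens_id : forall X Y : Ob C, idm X ⊗ idm Y = idm (X ⊗ Y);
  tens_comp : forall f f' g g' : Mor C,
    cod f = dom f' -> cod g = dom g' ->
    (f' ∘ f) ⊗ (g' ∘ g) = (f' ⊗ g') ∘ (f ⊗ g);
  tensO_assoc : forall X Y Z : Ob C, (X ⊗ (Y ⊗ Z) = (X ⊗ Y) ⊗ Z)%ob;
  tensO_unitl : forall X : Ob C, (unitO ⊗ X = X)%ob;
  tensO_unitr : forall X : Ob C, (X ⊗ unitO = X)%ob;
  tensm_assoc : forall f g h : Mor C, f ⊗ (g ⊗ h) = (f ⊗ g) ⊗ h;
  tensm_unitl : forall f : Mor C, idm unitO ⊗ f = f;
  tensm_unitr : forall f : Mor C, f ⊗ idm unitO = f
}.

Record is_braiding (C : cat_data) : Prop := {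
  hom_braid : forall X Y : Ob C, Hom (X ⊗ Y) (Y ⊗ X) (braid X Y);
  braid_iso : forall X Y : Ob C, exists psi, Hom (Y ⊗ X) (X ⊗ Y) psi /\
    psi ∘ braid X Y = idm (X ⊗ Y) /\ braid X Y ∘ psi = idm (Y ⊗ X);
  braid_nat : forall (X X' Y Y' : Ob C) f g, Hom X X' f -> Hom Y Y' g ->
    braid X' Y' ∘ (f ⊗ g) = (g ⊗ f) ∘ braid X Y;
  braid_hexl : forall X Y Z : Ob C,
    braid (X ⊗ Y) Z = (braid X Z ⊗ idm Y) ∘ (idm X ⊗ braid Y Z);
  braid_hexr : forall X Y Z : Ob C,
    braid X (Y ⊗ Z) = (idm Y ⊗ braid X Z) ∘ (braid X Y ⊗ idm Z)
}.

Record is_tensor_compatible (C : cat_data) : Prop := {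
  tens_addl : forall f g h : Mor C,
    parallel f g -> (f + g) ⊗ h = f ⊗ h + g ⊗ h;
  tens_addr : forall f g h : Mor C,
    parallel f g -> h ⊗ (f + g) = h ⊗ f + h ⊗ g;
  tens_eql : forall (X : Ob C) e f g, is_equaliser e f g ->
    is_equaliser (idm X ⊗ e) (idm X ⊗ f) (idm X ⊗ g);
  tens_eqr : forall (X : Ob C) e f g, is_equaliser e f g ->
    is_equaliser (e ⊗ idm X) (f ⊗ idm X) (g ⊗ idm X);
  tens_coeql : forall (X : Ob C) c f g, is_coequaliser c f g ->
    is_coequaliser (idm X ⊗ c) (idm X ⊗ f) (idm X ⊗ g);
  tens_coeqr : forall (X : Ob C) c f g, is_coequaliser c f g ->
    is_coequaliser (c ⊗ idm X) (f ⊗ idm X) (g ⊗ idm X)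
}.

Record is_braided_abelian (C : cat_data) : Prop := {
  ba_abelian : is_abelian C;
  ba_monoidal : is_strict_monoidal C;
  ba_braiding : is_braiding C;
  ba_compatible : is_tensor_compatible C
}.

(** * Algebras, braided groups, comodule algebras *)

Record alg (C : cat_data) : Type := Alg {
  acar :> Ob C;
  mul : Mor C;
  one : Mor C
}.

Record bgroup (C : cat_data) : Type := BGroup {
  balg :> alg C;
  cop : Mor C;
  cou : Mor C;
  anti : Mor C
}.

Arguments mul {C}.
Arguments one {C}.
Arguments cop {C}.
Arguments cou {C}.
Arguments anti {C}.

Section Algebra.
Variable C : cat_data.
Implicit Types (f g : Mor C) (V W : Ob C).

Record is_alg (A : alg C) : Prop := {
  hom_mul : Hom (A ⊗ A) A (mul A);
  hom_one : Hom unitO A (one A);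
  mul_assoc : mul A ∘ (mul A ⊗ idm A) = mul A ∘ (idm A ⊗ mul A);
  mul_onel : mul A ∘ (one A ⊗ idm A) = idm A;
  mul_oner : mul A ∘ (idm A ⊗ one A) = idm A
}.

Definition unit_alg : alg C := Alg unitO (idm unitO) (idm unitO).

Definition braided_tensor (X Y : alg C) : alg C :=
  Alg (X ⊗ Y) ((mul X ⊗ mul Y) ∘ (idm X ⊗ braid Y X ⊗ idm Y)) (one X ⊗ one Y).

Record alg_morphism (X Y : alg C) f : Prop := {
  hom_alg : Hom X Y f;
  alg_mul : f ∘ mul X = mul Y ∘ (f ⊗ f);
  alg_one : f ∘ one X = one Y
}.

(** Convolution of morphisms out of the coalgebra [B], with respect to
    [m : cod f ⊗ cod g -> Z]. *)
Definition conv (B : bgroup C) (m f g : Mor C) : Mor C :=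
  m ∘ (f ⊗ g) ∘ cop B.

Definition conv_inverse (B : bgroup C) (A : alg C) f g : Prop :=
  conv B (mul A) f g = one A ∘ cou B /\ conv B (mul A) g f = one A ∘ cou B.

Record is_braided_group (B : bgroup C) : Prop := {
  bg_alg : is_alg B;
  hom_cop : Hom B (B ⊗ B) (cop B);
  hom_cou : Hom B unitO (cou B);
  cop_assoc : (cop B ⊗ idm B) ∘ cop B = (idm B ⊗ cop B) ∘ cop B;
  cou_l : (cou B ⊗ idm B) ∘ cop B = idm B;
  cou_r : (idm B ⊗ cou B) ∘ cop B = idm B;
  cop_alg : alg_morphism B (braided_tensor B B) (cop B);
  cou_alg : alg_morphism B unit_alg (cou B);
  hom_anti : Hom B B (anti B);
  anti_inv : conv_inverse B B (idm B) (anti B)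
}.

Definition Ad (B : bgroup C) : Mor C :=
  (idm B ⊗ mul B) ∘ (braid B B ⊗ idm B) ∘ (anti B ⊗ cop B) ∘ cop B.

Record is_comodule (B : bgroup C) V rho : Prop := {
  hom_coact : Hom V (V ⊗ B) rho;
  coact_cop : (rho ⊗ idm B) ∘ rho = (idm V ⊗ cop B) ∘ rho;
  coact_cou : (idm V ⊗ cou B) ∘ rho = idm V
}.

Record is_comodule_algebra (B : bgroup C) (P : alg C) rho : Prop := {
  ca_alg : is_alg P;
  ca_comodule : is_comodule B P rho;
  ca_alg_morphism : alg_morphism P (braided_tensor P B) rho
}.

Definition tens_coact (B : bgroup C) V rhoV W rhoW : Mor C :=
  (idm V ⊗ idm W ⊗ mul B) ∘ (idm V ⊗ braid B W ⊗ idm B) ∘ (rhoV ⊗ rhoW).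

(** The algebra structure on the subobject [i : M -> P] of an algebra, induced
    by that of [P] (when [M] is closed under product and contains the unit). *)
Definition sub_alg (P : alg C) (i : Mor C) : alg C :=
  Alg (dom i) (factor i (mul P ∘ (i ⊗ i))) (factor i (one P)).

Record is_right_module (M : alg C) V act : Prop := {
  hom_ract : Hom (V ⊗ M) V act;
  ract_mul : act ∘ (act ⊗ idm M) = act ∘ (idm V ⊗ mul M);
  ract_one : act ∘ (idm V ⊗ one M) = idm V
}.

(** [q : V ⊗ N -> V ⊗_M N] for a right module [V] and a left module [N]. *)
Definition is_tensor_over (M : alg C) V actV (N : Ob C) actN q : Prop :=
  is_coequaliser q (actV ⊗ idm N) (idm V ⊗ actN).

(** The left module [N] is flat: (-) ⊗_M N sends monomorphisms of right
    [M]-modules to monomorphisms. *)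
Definition flat (M : alg C) (N : Ob C) actN : Prop :=
  forall (V : Ob C) actV (W : Ob C) actW (f qV qW h : Mor C),
    is_right_module M V actV -> is_right_module M W actW ->
    Hom V W f -> f ∘ actV = actW ∘ (f ⊗ idm M) -> mono f ->
    is_tensor_over M V actV N actN qV -> is_tensor_over M W actW N actN qW ->
    Hom (cod qV) (cod qW) h -> h ∘ qV = qW ∘ (f ⊗ idm N) -> mono h.

End Algebra.

(** * Trivial braided principal bundles *)

Record tbundle (C : cat_data) : Type := TBundle {
  tot :> alg C;
  coact : Mor C;
  incl : Mor C;      (* the inclusion of M = P^B in P *)
  triv : Mor C;      (* Φ : B -> P *)
  triv_inv : Mor C   (* its convolution inverse *)
}.

Arguments coact {C}.
Arguments incl {C}.
Arguments triv {C}.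
Arguments triv_inv {C}.

Definition base (C : cat_data) (P : tbundle C) : alg C := sub_alg P (incl P).

Record is_trivial_bundle (C : cat_data) (B : bgroup C) (P : tbundle C) : Prop := {
  tb_comodule_algebra : is_comodule_algebra B P (coact P);
  tb_base : is_equaliser (incl P) (coact P) (idm P ⊗ one B);
  tb_flat : flat (base P) P (mul P ∘ (incl P ⊗ idm P));
  hom_triv : Hom B P (triv P);
  triv_coact : coact P ∘ triv P = (triv P ⊗ idm B) ∘ cop B;
  triv_one : triv P ∘ one B = one P;
  hom_triv_inv : Hom B P (triv_inv P);
  triv_convV : conv_inverse B P (triv P) (triv_inv P)
}.

(** * Universal 1-forms, connections *)

Section Forms.
Variables (C : cat_data) (B : bgroup C) (P : tbundle C).

(** [jP : Ω¹P -> P ⊗ P] and [jM : Ω¹M -> M ⊗ M] are kernels of the products. *)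
Variables jP jM : Mor C.

Definition forms_incl : Mor C := factor jP ((incl P ⊗ incl P) ∘ jM).

Definition forms_lact : Mor C := factor jP ((mul P ⊗ idm P) ∘ (idm P ⊗ jP)).
Definition forms_ract : Mor C := factor jP ((idm P ⊗ mul P) ∘ (jP ⊗ idm P)).

Definition diff : Mor C := factor jP (one P ⊗ idm P - idm P ⊗ one P).

Definition forms_coact : Mor C :=
  factor (jP ⊗ idm B) (tens_coact B P (coact P) P (coact P) ∘ jP).

Definition chi : Mor C := (mul P ⊗ idm B) ∘ (idm P ⊗ coact P).

Record is_connection (omega : Mor C) : Prop := {
  hom_omega : Hom B (dom jP) omega;
  omega_chi : chi ∘ jP ∘ omega = one P ⊗ (idm B - one B ∘ cou B);
  omega_one : omega ∘ one B = zerom unitO (dom jP);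
  omega_Ad : forms_coact ∘ omega = (omega ⊗ idm B) ∘ Ad B
}.

Definition proj (omega : Mor C) : Mor C :=
  forms_lact ∘ (idm P ⊗ omega) ∘ (chi ∘ jP).

(** The image of [right_span : Ω¹M ⊗ P -> Ω¹P] is (Ω¹M)P. *)
Definition right_span : Mor C := forms_ract ∘ (forms_incl ⊗ idm P).

Definition is_strong (omega : Mor C) : Prop :=
  factors_through_image ((idm (dom jP) - proj omega) ∘ diff) right_span.

Definition is_strong_connection (omega : Mor C) : Prop :=
  is_connection omega /\ is_strong omega.

Definition is_gauge_form (A : Mor C) : Prop :=
  Hom B (dom jM) A /\ A ∘ one B = zerom unitO (dom jM).

(** Convolution of a form with a function on the right, on the left. *)
Definition convl (f alpha : Mor C) : Mor C := conv B forms_lact f alpha.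
Definition convr (alpha f : Mor C) : Mor C := conv B forms_ract alpha f.

(** Φ⁻¹ * dΦ + Φ⁻¹ * A * Φ *)
Definition omega_of (A : Mor C) : Mor C :=
  convl (triv_inv P) (diff ∘ triv P)
  + convr (convl (triv_inv P) (forms_incl ∘ A)) (triv P).

(** Φ * ω * Φ⁻¹ - (dΦ) * Φ⁻¹, as a morphism to Ω¹P *)
Definition gauge_expr (omega : Mor C) : Mor C :=
  convr (convl (triv P) omega) (triv_inv P)
  - convr (diff ∘ triv P) (triv_inv P).

(** The same, corestricted to Ω¹M. *)
Definition gauge_of (omega : Mor C) : Mor C := factor forms_incl (gauge_expr omega).

End Forms.

(* Main.v *)
(** Let u be the unit of P ⊗ P composed with the counit of B.  With
    ω' = ω + u and A' = A + u the two formulas become ω' = Φ⁻¹ * A' * Φ and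
    A' = Φ * ω' * Φ⁻¹, visibly inverse to each other: dΦ is absorbed because
    Φ⁻¹ * u * Φ = (Φ⁻¹ ⊗ Φ) ∘ Δ.  The bimodule actions of P on P ⊗ P are
    multiplications in the braided tensor algebra Q of P with itself, through
    the two embeddings of P, so everything takes place in convolution algebras.

    Covariance.  In E = (Q braided ⊗ B), put λ(p) = p₀ ⊗ 1 ⊗ p₁ and
    μ(p) = 1 ⊗ p₀ ⊗ p₁.  These are algebra morphisms, the tensor product
    coaction is mult ∘ (λ ⊗ μ), and (F ⊗ id) ∘ Ad = S * (F ⊗ η) * id in
    Hom(B, E).  Since λ ∘ Φ = Φ * id and λ ∘ Φ⁻¹ = S * Φ⁻¹ there (likewise for
    μ), ω' is Ad-covariant iff A' is coinvariant.

    Strength.  (id - Π) d p = 1 ⊗ p - p₀ ω'(p₁).  If A takes values in Ω¹M, then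
    with s(p) = p₀ Φ⁻¹(p₁) in M this is d(s(p₀)) Φ(p₁) - s(p₀) A(p₁) Φ(p₂), which
    lies in (Ω¹M)P.  Conversely, for strong ω the morphism Φ * ω' lands in M ⊗ P,
    hence so does A'; on M ⊗ P the tensor coaction is that of the second factor,
    so coinvariance puts A' in M ⊗ M. *)

From Stdlib Require Import ClassicalEpsilon.
Require Import Defs.

Set Implicit Arguments.
Unset Strict Implicit.
Unset Printing Implicit Defensive.

Local Open Scope mor_scope.

Create HintDb hom.

(** * Typing and rewriting rules of the strict monoidal category *)

Section Kit.
Context (C : cat_data) (hC : is_braided_abelian C).
Implicit Types (f g h : Mor C) (X Y Z : Ob C).

Let hK := ab_category (ba_abelian hC).
Let hA := ab_preadditive (ba_abelian hC).
Let hM := ba_monoidal hC.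
Let hS := ba_braiding hC.

Lemma hom_eq X Y X' Y' f : Hom X Y f -> X = X' -> Y = Y' -> Hom X' Y' f.
Proof. intros; subst; assumption. Qed.

Lemma hom_compE X Y Y' Z f g :
  Hom X Y f -> Hom Y' Z g -> Y = Y' -> Hom X Z (g ∘ f).
Proof. intros; subst; eapply (hom_comp hK); eassumption. Qed.

Lemma hom_addE X Y X' Y' f g :
  Hom X Y f -> Hom X' Y' g -> X' = X -> Y' = Y -> Hom X Y (f + g).
Proof. intros; subst; now apply (hom_add hA). Qed.

Lemma composable X Y Y' Z f g :
  Hom X Y f -> Hom Y' Z g -> Y = Y' -> cod f = dom g.
Proof. intros [_ e] [e' _]; congruence. Qed.

Lemma parallelI X Y X' Y' f g :
  Hom X Y f -> Hom X' Y' g -> X = X' -> Y = Y' -> parallel f g.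
Proof. intros [] []; split; congruence. Qed.

Lemma hom_self f : Hom (dom f) (cod f) f.
Proof. now split. Qed.

Lemma hom_dom X Y f : Hom X Y f -> dom f = X.
Proof. now intros []. Qed.

Lemma hom_cod X Y f : Hom X Y f -> cod f = Y.
Proof. now intros []. Qed.

Lemma hom_tensE X Y X' Y' f g :
    Hom X Y f -> Hom X' Y' g -> Hom (X ⊗ X') (Y ⊗ Y') (f ⊗ g).
Proof. apply (hom_tens hM). Qed.

Lemma hom_idE X : Hom X X (idm X). Proof. apply (hom_id hK). Qed.
Lemma hom_zeroE X Y : Hom X Y (zerom X Y). Proof. apply (hom_zero hA). Qed.
Lemma hom_oppE X Y f : Hom X Y f -> Hom X Y (- f). Proof. apply (hom_opp hA). Qed.
Lemma hom_braidE X Y : Hom (X ⊗ Y) (Y ⊗ X) (braid X Y).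
Proof. apply (hom_braid hS). Qed.

Lemma obA X Y Z : (X ⊗ (Y ⊗ Z) = X ⊗ Y ⊗ Z)%ob. Proof. apply (tensO_assoc hM). Qed.
Lemma ob1l X : (unitO ⊗ X = X)%ob. Proof. apply (tensO_unitl hM). Qed.
Lemma ob1r X : (X ⊗ unitO = X)%ob. Proof. apply (tensO_unitr hM). Qed.

Lemma compA f g h : cod f = dom g -> cod g = dom h -> h ∘ (g ∘ f) = h ∘ g ∘ f.
Proof. apply (comp_assoc hK). Qed.
Lemma comp1r X f : dom f = X -> f ∘ idm X = f.
Proof. intros <-; apply (comp_idr hK). Qed.
Lemma comp1l X f : cod f = X -> idm X ∘ f = f.
Proof. intros <-; apply (comp_idl hK). Qed.
Lemma tensE f f' g g' : cod f = dom f' -> cod g = dom g' ->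
  (f' ⊗ g') ∘ (f ⊗ g) = (f' ∘ f) ⊗ (g' ∘ g).
Proof. intros; symmetry; now apply (tens_comp hM). Qed.
Lemma tensA f g h : f ⊗ (g ⊗ h) = f ⊗ g ⊗ h.
Proof. apply (tensm_assoc hM). Qed.
Lemma tens1l f : idm unitO ⊗ f = f. Proof. apply (tensm_unitl hM). Qed.
Lemma tens1r f : f ⊗ idm unitO = f. Proof. apply (tensm_unitr hM). Qed.
Lemma tens11 X Y : idm X ⊗ idm Y = idm (X ⊗ Y). Proof. apply (tens_id hM). Qed.
End Kit.

#[export] Hint Resolve hom_idE hom_zeroE hom_braidE hom_mul hom_one : hom.

(* Domains and codomains agree only up to the strict associativity and unit laws
   of objects, so [hom] infers them structurally and compares normal forms. *)
Ltac obj :=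
  try reflexivity; cbn [acar mul one braided_tensor unit_alg];
  try match goal with
  | h : is_braided_abelian _ |- _ =>
      rewrite ?(obA h), ?(ob1l h), ?(ob1r h)
  end; reflexivity.

Ltac infer :=
  lazymatch goal with
  | h : is_braided_abelian _ |- Hom _ _ (_ ∘ _) => eapply (hom_compE h); [infer | infer | obj]
  | h : is_braided_abelian _ |- Hom _ _ (_ ⊗ _) => eapply (hom_tensE h); [infer | infer]
  | h : is_braided_abelian _ |- Hom _ _ (_ + _) => eapply (hom_addE h); [infer | infer | obj | obj]
  | h : is_braided_abelian _ |- Hom _ _ (- _) => eapply (hom_oppE h); infer
  | |- _ => first [eassumption | solve [eauto 4 with hom] | apply hom_self]
  end.

Ltac hom :=
  lazymatch goal with
  | |- cod _ = dom _ => eapply composable; [infer | infer | obj]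
  | |- dom _ = _ => eapply eq_trans; [eapply hom_dom; infer | obj]
  | |- cod _ = _ => eapply eq_trans; [eapply hom_cod; infer | obj]
  | |- _ = cod _ => symmetry; hom
  | |- parallel _ _ => eapply parallelI; [infer | infer | obj | obj]
  | |- Hom _ _ _ => eapply hom_eq; [infer | obj | obj]
  end.

Ltac withC tac := match goal with h : is_braided_abelian _ |- _ => tac h end.
Ltac ids := withC ltac:(fun h =>
  repeat (first [rewrite (tens11 h) | rewrite (comp1r h) by hom | rewrite (comp1l h) by hom])).

Lemma whisker (C : cat_data) (hC : is_braided_abelian C) (X Y U V W : Ob C)
    (f g : Mor C) : Hom U V f -> Hom V W g ->
  idm X ⊗ (g ∘ f) ⊗ idm Y = (idm X ⊗ g ⊗ idm Y) ∘ (idm X ⊗ f ⊗ idm Y).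
Proof. intros hf hg. rewrite !(tensE hC) by hom. now ids. Qed.

(** * The braiding with the unit object *)

Section Braid.
Context (C : cat_data) (hC : is_braided_abelian C).
Implicit Types (f g h : Mor C) (X Y Z : Ob C).
Let hS := ba_braiding hC.

Lemma braid_natE X X' Y Y' f g : Hom X X' f -> Hom Y Y' g ->
    braid X' Y' ∘ (f ⊗ g) = (g ⊗ f) ∘ braid X Y.
Proof. intros; now apply (braid_nat hS). Qed.

Lemma idempotent_iso X f g :
  Hom X X f -> Hom X X g -> f ∘ f = f -> g ∘ f = idm X -> f = idm X.
Proof.
intros hf hg ff gf.
assert (e : g ∘ (f ∘ f) = g ∘ f) by now rewrite ff.
rewrite (compA hC) in e by hom.
rewrite gf, (comp1l hC) in e by hom.
exact e.
Qed.

(** The hexagon at [unitO ⊗ unitO] makes this braiding idempotent, and an invertible idempotent is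
    an identity. *)
Lemma braid1l X : braid unitO X = idm X.
Proof.
destruct (braid_iso hS unitO X) as [psi [hpsi [e _]]].
assert (h : Hom X X (braid unitO X)) by hom.
apply idempotent_iso with psi; try hom.
- generalize (braid_hexl hS unitO unitO X).
  rewrite (ob1l hC), (tens1l hC), (tens1r hC); auto.
- now rewrite e, (ob1l hC).
Qed.

Lemma braid1r X : braid X unitO = idm X.
Proof.
destruct (braid_iso hS X unitO) as [psi [hpsi [e _]]].
assert (h : Hom X X (braid X unitO)) by hom.
apply idempotent_iso with psi; try hom.
- generalize (braid_hexr hS X unitO unitO).
  rewrite (ob1l hC), (tens1l hC), (tens1r hC); auto.
- now rewrite e, (ob1r hC).
Qed.

Lemma braid_unitl X Y f : Hom unitO X f ->
  braid X Y ∘ (f ⊗ idm Y) = idm Y ⊗ f.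
Proof.
intros hf. rewrite (braid_natE hf (hom_idE hC Y)).
rewrite braid1l. now ids.
Qed.

Lemma braid_unitr X Y f : Hom unitO X f ->
  braid Y X ∘ (idm Y ⊗ f) = f ⊗ idm Y.
Proof.
intros hf. rewrite (braid_natE (hom_idE hC Y) hf).
rewrite braid1r. now ids.
Qed.

End Braid.

(** * Additive structure and subobjects *)

Section Additive.
Context (C : cat_data) (hC : is_braided_abelian C).
Implicit Types (f g h k : Mor C) (X Y Z : Ob C).
Let hA := ab_preadditive (ba_abelian hC).
Let hT := ba_compatible hC.

Lemma parallel_hom f g : parallel f g -> Hom (dom f) (cod f) g.
Proof. intros []; split; congruence. Qed.

Lemma addA f g h : parallel f g -> parallel f h -> f + (g + h) = f + g + h.
Proof.
intros hg hh. apply parallel_hom in hg, hh.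
now apply (add_assoc hA (X := dom f) (Y := cod f)).
Qed.

Lemma addC f g : parallel f g -> f + g = g + f.
Proof.
intros hg. apply parallel_hom in hg.
now apply (add_comm hA (X := dom f) (Y := cod f)).
Qed.

Lemma addr0 X Y f : Hom X Y f -> f + zerom X Y = f.
Proof. apply (add_zero hA). Qed.

Lemma add0r X Y f : Hom X Y f -> zerom X Y + f = f.
Proof. intros h. rewrite addC by hom. now apply addr0. Qed.

Lemma subrr X Y f : Hom X Y f -> f - f = zerom X Y.
Proof. apply (add_opp hA). Qed.

Lemma addrK f g : parallel f g -> f + g - g = f.
Proof.
intros hg. apply parallel_hom in hg.
rewrite <- addA by hom. rewrite (subrr hg). now apply addr0.
Qed.

Lemma subrK f g : parallel f g -> f - g + g = f.
Proof.
intros hg. apply parallel_hom in hg.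
rewrite <- addA, (addC (f := - g)) by hom. rewrite (subrr hg). now apply addr0.
Qed.

Lemma addIr f g h : parallel f h -> parallel g h -> f + h = g + h -> f = g.
Proof. intros hf hg e. rewrite <- (addrK hf), e. now apply addrK. Qed.

(** The axioms state additivity only; uniqueness of opposites extends it to differences, for
    composition and for the tensor product. *)
Lemma oppr_unique X Y f g : Hom X Y f -> Hom X Y g -> f + g = zerom X Y -> f = - g.
Proof.
intros hf hg e. apply addIr with g; try hom.
rewrite e, (addC (f := - g)) by hom. symmetry; now apply subrr.
Qed.

Lemma subr0_eq X Y f g : Hom X Y f -> Hom X Y g -> f - g = zerom X Y -> f = g.
Proof.
intros hf hg e. apply addIr with (- g); try hom.
now rewrite e, (subrr hg).
Qed.

(** Additivity shows that a composite or tensor product with zero equals its own double; this lemma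
    then makes it vanish. *)
Lemma addrr_zero X Y f : Hom X Y f -> f + f = f -> f = zerom X Y.
Proof.
intros hf e. apply addIr with f; try hom.
now rewrite e, (add0r hf).
Qed.

Lemma compDl f g h : cod f = dom g -> parallel g h -> (g + h) ∘ f = g ∘ f + h ∘ f.
Proof.
intros e hg. apply parallel_hom in hg.
now apply (comp_addl hA (X := dom f) (Y := dom g) (Z := cod g)).
Qed.

Lemma compDr f g h : cod f = dom h -> parallel f g -> h ∘ (f + g) = h ∘ f + h ∘ g.
Proof.
intros e hg. apply parallel_hom in hg.
apply (comp_addr hA (X := dom f) (Y := cod f) (Z := cod h));
  try split; auto; now destruct hg.
Qed.

Lemma comp0l X Y Z f : Hom X Y f -> zerom Y Z ∘ f = zerom X Z.
Proof.
intros hf. apply addrr_zero; try hom.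
rewrite <- compDl by hom. now rewrite (addr0 (hom_zeroE hC _ _)).
Qed.

Lemma comp0r X Y Z f : Hom Y Z f -> f ∘ zerom X Y = zerom X Z.
Proof.
intros hf. apply addrr_zero; try hom.
rewrite <- compDr by hom. now rewrite (addr0 (hom_zeroE hC _ _)).
Qed.

Lemma compBl f g h : cod f = dom g -> parallel g h -> (g - h) ∘ f = g ∘ f - h ∘ f.
Proof.
intros e hg. assert (hf : Hom (dom f) (dom g) f) by now split.
apply parallel_hom in hg.
rewrite compDl by hom. f_equal.
apply oppr_unique with (dom f) (cod g); try hom.
rewrite <- compDl by hom. rewrite (addC (f := - h)) by hom.
rewrite (subrr hg). now apply comp0l.
Qed.

Lemma compBr f g h : cod f = dom h -> parallel f g -> h ∘ (f - g) = h ∘ f - h ∘ g.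
Proof.
intros e hg. assert (hf : Hom (cod f) (cod h) h) by now split.
apply parallel_hom in hg.
rewrite compDr by hom. f_equal.
apply oppr_unique with (dom f) (cod h); try hom.
rewrite <- compDr by hom. rewrite (addC (f := - g)) by hom.
rewrite (subrr hg). now apply comp0r.
Qed.

Lemma tensDl f g h : parallel f g -> (f + g) ⊗ h = f ⊗ h + g ⊗ h.
Proof. apply (tens_addl hT). Qed.

Lemma tensDr f g h : parallel f g -> h ⊗ (f + g) = h ⊗ f + h ⊗ g.
Proof. apply (tens_addr hT). Qed.

Lemma tens0l X Y Z W f : Hom Z W f -> zerom X Y ⊗ f = zerom (X ⊗ Z) (Y ⊗ W).
Proof.
intros hf. apply addrr_zero; try hom.
rewrite <- tensDl by hom. now rewrite (addr0 (hom_zeroE hC _ _)).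
Qed.

Lemma tens0r X Y Z W f : Hom Z W f -> f ⊗ zerom X Y = zerom (Z ⊗ X) (W ⊗ Y).
Proof.
intros hf. apply addrr_zero; try hom.
rewrite <- tensDr by hom. now rewrite (addr0 (hom_zeroE hC _ _)).
Qed.

Lemma tensBl X Y f g h : Hom X Y h -> parallel f g -> (f - g) ⊗ h = f ⊗ h - g ⊗ h.
Proof.
intros hh hg. apply parallel_hom in hg.
rewrite tensDl by hom. f_equal.
apply oppr_unique with (dom f ⊗ X)%ob (cod f ⊗ Y)%ob; try hom.
rewrite <- tensDl by hom. rewrite (addC (f := - g)) by hom.
rewrite (subrr hg). now apply tens0l.
Qed.

Lemma tensBr X Y f g h : Hom X Y h -> parallel f g -> h ⊗ (f - g) = h ⊗ f - h ⊗ g.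
Proof.
intros hh hg. apply parallel_hom in hg.
rewrite tensDr by hom. f_equal.
apply oppr_unique with (X ⊗ dom f)%ob (Y ⊗ cod f)%ob; try hom.
rewrite <- tensDr by hom. rewrite (addC (f := - g)) by hom.
rewrite (subrr hg). now apply tens0r.
Qed.

End Additive.

(** * Monomorphisms, kernels and images *)

Section Subobjects.
Context (C : cat_data) (hC : is_braided_abelian C).
Implicit Types (e f g h j m : Mor C) (X Y Z : Ob C).

Lemma mono_eq X Y m f g :
  mono m -> dom m = Y -> Hom X Y f -> Hom X Y g -> m ∘ f = m ∘ g -> f = g.
Proof. intros hm <-; apply hm. Qed.

Lemma mono_comp X Y m m' : Hom X Y m -> mono m -> mono m' -> dom m' = Y ->
  mono (m' ∘ m).
Proof.
intros h hm hm' e Z f g hf hg E.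
assert (h' : Hom Y (cod m') m') by now split.
rewrite (hom_dom (f := m' ∘ m) (X := X) (Y := cod m')) in hf, hg by hom.
rewrite <- !(compA hC) in E by hom.
rewrite <- (hom_dom h) in hf, hg.
apply hm with Z; auto. rewrite (hom_dom h) in hf, hg.
apply hm' with Z; auto; rewrite e; hom.
Qed.

(** The chosen [factor] means something only once a factorisation is known to exist; each later use
    supplies one from an equaliser or from an explicit witness. *)
Lemma factorP e f :
  (exists u, Hom (dom f) (dom e) u /\ e ∘ u = f) ->
  Hom (dom f) (dom e) (factor e f) /\ e ∘ factor e f = f.
Proof. intros h. exact (epsilon_spec _ _ h). Qed.

Lemma equaliser_mono e f g : is_equaliser e f g -> mono e.
Proof.
intros [[hd _] hc he hu] X a b ha hb E.
assert (hE : Hom (dom e) (dom f) e) by now split.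
destruct (hu (e ∘ b)) as [u [_ U]].
- hom.
- assert (hg : Hom (dom f) (cod g) g) by now split.
  rewrite !(compA hC) by hom. now rewrite he.
- rewrite (hom_dom (f := e ∘ b) (X := X) (Y := dom f)) in U by hom.
  rewrite <- (U a), <- (U b); auto.
Qed.

Lemma equaliser_lift e f g h : is_equaliser e f g ->
  cod h = dom f -> f ∘ h = g ∘ h -> exists u, Hom (dom h) (dom e) u /\ e ∘ u = h.
Proof.
intros [_ _ _ hu] hh E. destruct (hu h hh E) as [u [hu' _]]. now exists u.
Qed.

Lemma hom_equaliser e f g : is_equaliser e f g -> Hom (dom e) (dom f) e.
Proof. intros [_ h _ _]; now split. Qed.

Lemma kernel_comp X Y j f : is_kernel j f -> Hom X Y f -> f ∘ j = zerom (dom j) Y.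
Proof.
intros h hf. assert (hj := hom_equaliser h).
rewrite (eq_comm h), (hom_dom hf), (hom_cod hf) in *.
now apply (comp0l hC).
Qed.

Lemma kernel_lift X Y Z j f h : is_kernel j f -> Hom X Y f -> Hom Z X h ->
  f ∘ h = zerom Z Y -> exists u, Hom Z (dom j) u /\ j ∘ u = h.
Proof.
intros hk hf hh E. rewrite <- (hom_dom hh).
apply (equaliser_lift hk).
- hom.
- rewrite E, (hom_dom hf), (hom_cod hf). symmetry. now apply (comp0l hC).
Qed.

Lemma cokernel_factor X Y Z c f h : is_cokernel c f -> Hom X Y f -> Hom Y Z h ->
  h ∘ f = zerom X Z -> exists u, Hom (cod c) Z u /\ u ∘ c = h.
Proof.
intros [_ _ _ hu] hf hh E. rewrite <- (hom_cod hh).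
destruct (hu h) as [u [hu' _]]; [| |now exists u].
- now rewrite (hom_dom hh), (hom_cod hf).
- rewrite E, (hom_dom hf), (hom_cod hf). symmetry. now apply (comp0r hC).
Qed.

Lemma kernel_factor X Y Z j f h : is_kernel j f -> Hom X Y f -> Hom Z X h ->
  f ∘ h = zerom Z Y -> Hom Z (dom j) (factor j h) /\ j ∘ factor j h = h.
Proof.
intros hk hf hh E. rewrite <- (hom_dom hh) at 1. apply factorP.
rewrite (hom_dom hh). now apply (kernel_lift hk hf hh).
Qed.

(* A morphism killing [g] factors through the cokernel of [g], hence kills its image. *)
Lemma image_annihilated X Y Z W f g h : factors_through_image f g ->
  Hom X Y g -> Hom W Y f -> Hom Y Z h -> h ∘ g = zerom X Z -> h ∘ f = zerom W Z.
Proof.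
intros [m [u [[c [hc hm]] [hu E]]]] hg hf hh e.
destruct (cokernel_factor hc hg hh e) as [k [hk E']].
assert (hc' : Hom Y (cod c) c).
{ split; auto. rewrite (coeq_dom hc). hom. }
assert (hm' := hom_equaliser hm).
rewrite <- E, <- E'. rewrite (hom_dom hf) in hu. rewrite (hom_dom hc') in hm'.
rewrite <- (compA hC), (compA hC (h := c)) by hom.
rewrite (kernel_comp hm hc'), (comp0l hC _ hu). now apply (comp0r hC).
Qed.

(** The cokernel of [g] kills [g ∘ t], which therefore lifts to the kernel of that cokernel. *)
Lemma factors_through_imageI W X Y f g t : Hom X Y g -> Hom W X t -> g ∘ t = f ->
  factors_through_image f g.
Proof.
intros hg ht <-.
destruct (ab_cokernel (ba_abelian hC) g) as [c hc].
destruct (ab_kernel (ba_abelian hC) c) as [m hm].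
assert (hc' : Hom Y (cod c) c).
{ split; auto. rewrite (coeq_dom hc). hom. }
assert (E : c ∘ g = zerom X (cod c)).
{ rewrite (coeq_comm hc), (hom_dom hg), (hom_cod hg). now apply (comp0r hC). }
destruct (kernel_lift (Z := W) (h := g ∘ t) hm hc') as [u [hu E']].
- hom.
- rewrite (compA hC), E by hom. now apply (comp0l hC).
- exists m, u. split; [now exists c|]. split; auto.
  rewrite (hom_dom (f := g ∘ t) (X := W) (Y := Y)) by hom. auto.
Qed.

End Subobjects.

(** * Braided tensor product of algebras *)

Definition inl (C : cat_data) (X Y : alg C) : Mor C := idm X ⊗ one Y.
Definition inr (C : cat_data) (X Y : alg C) : Mor C := one X ⊗ idm Y.

Section BraidedTensor.
Context (C : cat_data) (hC : is_braided_abelian C).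
Implicit Types (f g h : Mor C) (X Y Z : alg C).
Let hS := ba_braiding hC.

Section Two.
Context (X Y : alg C) (hX : is_alg X) (hY : is_alg Y).
Local Notation m := (mul X).
Local Notation n := (mul Y).
Local Notation x := (idm X).
Local Notation y := (idm Y).

Lemma hom_mul_tens : Hom (X ⊗ Y ⊗ (X ⊗ Y)) (X ⊗ Y) (mul (braided_tensor X Y)).
Proof. cbn [mul one acar braided_tensor]; hom. Qed.

Lemma hom_one_tens : Hom unitO (X ⊗ Y) (one (braided_tensor X Y)).
Proof. cbn [mul one acar braided_tensor]; hom. Qed.

Lemma hom_inl : Hom X (X ⊗ Y) (inl X Y).
Proof. unfold inl; hom. Qed.

Lemma hom_inr : Hom Y (X ⊗ Y) (inr X Y).
Proof. unfold inr; hom. Qed.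

Local Hint Resolve hom_mul_tens hom_one_tens hom_inl hom_inr : hom.

Lemma idm_tens : idm (braided_tensor X Y) = x ⊗ y.
Proof. symmetry. apply (tens11 hC). Qed.

(** Only the unit of [Y] is braided past [X], so no braiding survives and the product is the left
    action of [X] on the first factor. *)
Lemma mul_inl_id : mul (braided_tensor X Y) ∘ (inl X Y ⊗ (x ⊗ y)) = m ⊗ y.
Proof.
unfold inl; cbn [mul one acar braided_tensor].
rewrite <- (compA hC) by hom.
rewrite (tensA hC (x ⊗ one Y)), <- (tensA hC x (one Y)).
rewrite (tensE hC (g' := y)), (tensE hC (f' := x)) by hom.
rewrite (braid_unitl hC) by hom.
rewrite !(tensA hC); ids.
rewrite <- (tensA hC), (tensE hC) by hom.
rewrite (mul_onel hY). now ids.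
Qed.

Lemma mul_id_inr : mul (braided_tensor X Y) ∘ ((x ⊗ y) ⊗ inr X Y) = x ⊗ n.
Proof.
unfold inr; cbn [mul one acar braided_tensor].
rewrite <- (compA hC) by hom.
rewrite (tensA hC (x ⊗ y)), <- (tensA hC x y (one X)).
rewrite (tensE hC (g' := y)), (tensE hC (f' := x)) by hom.
rewrite (braid_unitr hC) by hom.
rewrite !(tensA hC); ids.
rewrite <- (tensA hC), (tensE hC) by hom.
rewrite (mul_oner hX). now ids.
Qed.

(** With the left factor in the second leg the braiding stays; this is where the braiding of the
    adjoint coaction comes from. *)
Lemma mul_inr_id :
  mul (braided_tensor X Y) ∘ (inr X Y ⊗ (x ⊗ y)) = (x ⊗ n) ∘ (braid Y X ⊗ y).
Proof.
unfold inr. cbn [mul one acar braided_tensor].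
rewrite <- (compA hC) by hom.
rewrite <- (tensA hC x (braid Y X)), <- (tensA hC (one X)), (tensA hC y x).
rewrite (tensE hC (f' := x)) by hom. ids.
replace (one X ⊗ (braid Y X ⊗ y)) with ((one X ⊗ (x ⊗ y ⊗ y)) ∘ (braid Y X ⊗ y)).
2:{ rewrite <- (tens1l hC (braid Y X ⊗ y)) at 1. rewrite (tensE hC) by hom. now ids. }
rewrite (compA hC) by hom. f_equal.
rewrite <- (tensA hC x y y), (tensA hC (one X)), (tensE hC), (mul_onel hX) by hom. now ids.
Qed.

(** Both sides are a pair of triple products after a reordering of the strands. Naturality ([L] and
    [R]) pulls the inner products through the braiding, and the hexagons identify the two
    reorderings. *)
Lemma mul_tens_assoc :
  mul (braided_tensor X Y) ∘ (mul (braided_tensor X Y) ⊗ (x ⊗ y)) =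
  mul (braided_tensor X Y) ∘ ((x ⊗ y) ⊗ mul (braided_tensor X Y)).
Proof.
cbn [mul one acar braided_tensor].
assert (L : (x ⊗ braid Y X ⊗ y) ∘ (m ⊗ n ⊗ (x ⊗ y)) =
   (m ⊗ x ⊗ (n ⊗ y)) ∘ (x ⊗ x ⊗ braid (Y ⊗ Y) X ⊗ y)).
{ rewrite (tensA hC (m ⊗ n)), <- (tensA hC m n).
  rewrite (tensA hC (m ⊗ x)), <- (tensA hC m x).
  rewrite !(tensE hC) by hom.
  rewrite (braid_natE hC (hom_mul hY) (hom_idE hC X)). now ids. }
assert (R : (x ⊗ braid Y X ⊗ y) ∘ ((x ⊗ y) ⊗ (m ⊗ n)) =
   (x ⊗ m ⊗ (y ⊗ n)) ∘ (x ⊗ braid Y (X ⊗ X) ⊗ y ⊗ y)).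
{ rewrite (tensA hC (x ⊗ y)), <- (tensA hC x y).
  rewrite (tensA hC (x ⊗ m)), <- (tensA hC x m), <- (tensA hC (x ⊗ braid Y (X ⊗ X))).
  rewrite !(tensE hC) by hom.
  rewrite (braid_natE hC (hom_idE hC Y) (hom_mul hX)). now ids. }
transitivity (((m ∘ (m ⊗ x)) ⊗ (n ∘ (n ⊗ y))) ∘
  (x ⊗ (x ⊗ braid (Y ⊗ Y) X ∘ (braid Y X ⊗ y ⊗ x)) ⊗ y)).
- replace ((m ⊗ n) ∘ (x ⊗ braid Y X ⊗ y) ⊗ (x ⊗ y)) with
   ((m ⊗ n ⊗ (x ⊗ y)) ∘ ((x ⊗ braid Y X ⊗ y) ⊗ (x ⊗ y))).
  2:{ rewrite (tensE hC) by hom. now ids. }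
  rewrite (compA hC) by hom. rewrite <- (compA hC (h := m ⊗ n)) by hom.
  rewrite L.
  rewrite (compA hC), (tensE hC (f' := m) (g' := n)) by hom.
  rewrite <- (compA hC) by hom. f_equal.
  erewrite (whisker hC) by hom. now rewrite !(tensA hC).
- rewrite (mul_assoc hX), (mul_assoc hY).
  replace ((x ⊗ y) ⊗ ((m ⊗ n) ∘ (x ⊗ braid Y X ⊗ y))) with
   ((x ⊗ y ⊗ (m ⊗ n)) ∘ ((x ⊗ y) ⊗ (x ⊗ braid Y X ⊗ y))).
  2:{ rewrite (tensE hC) by hom. now ids. }
  rewrite (compA hC) by hom. rewrite <- (compA hC (h := m ⊗ n)) by hom.
  rewrite R.
  rewrite (compA hC), (tensE hC (f' := m) (g' := n)) by hom.
  rewrite <- (compA hC) by hom. f_equal.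
  replace ((x ⊗ braid Y (X ⊗ X) ⊗ y ⊗ y) ∘ (x ⊗ y ⊗ (x ⊗ braid Y X ⊗ y)))
   with (x ⊗ (braid Y (X ⊗ X) ⊗ y ∘ (y ⊗ x ⊗ braid Y X)) ⊗ y).
  2:{ erewrite (whisker hC) by hom. now rewrite !(tensA hC). }
  f_equal. f_equal.
  (* Each reordering splits into three elementary braidings with the same last one; the other two
     act on disjoint pairs of strands and commute. *)
  rewrite (braid_hexl hS), (braid_hexr hS).
  replace (x ⊗ (braid Y X ⊗ y ∘ (y ⊗ braid Y X))) with
    ((x ⊗ braid Y X ⊗ y) ∘ (x ⊗ y ⊗ braid Y X)).
  2:{ rewrite <- !(tensA hC). rewrite (tensE hC) by hom. now ids. }
  replace ((x ⊗ braid Y X ∘ (braid Y X ⊗ x)) ⊗ y) with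
    ((x ⊗ braid Y X ⊗ y) ∘ (braid Y X ⊗ x ⊗ y)).
  2:{ rewrite (tensE hC) by hom. now ids. }
  rewrite <- !(compA hC) by hom. f_equal.
  rewrite <- !(tensA hC (braid Y X)).
  ids.
  rewrite !(tensE hC) by hom. now ids.
Qed.

Lemma alg_tens : is_alg (braided_tensor X Y).
Proof.
split.
- apply hom_mul_tens.
- apply hom_one_tens.
- rewrite idm_tens. apply mul_tens_assoc.
- rewrite idm_tens.
  replace (one (braided_tensor X Y) ⊗ (x ⊗ y))
    with ((inl X Y ⊗ (x ⊗ y)) ∘ (one X ⊗ (x ⊗ y))).
  2:{ unfold inl. rewrite !(tensE hC) by hom.
      rewrite <- (tens1r hC (one X)) at 1. rewrite (tensE hC) by hom. now ids. }
  rewrite (compA hC), mul_inl_id by hom.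
  rewrite (tensA hC), (tensE hC), (mul_onel hX) by hom. now ids.
- rewrite idm_tens.
  replace ((x ⊗ y) ⊗ one (braided_tensor X Y))
    with (((x ⊗ y) ⊗ inr X Y) ∘ ((x ⊗ y) ⊗ one Y)).
  2:{ unfold inr. rewrite !(tensE hC) by hom.
      rewrite <- (tens1l hC (one Y)) at 1. rewrite (tensE hC) by hom. now ids. }
  rewrite (compA hC), mul_id_inr by hom.
  rewrite <- (tensA hC), (tensE hC), (mul_oner hY) by hom. now ids.
Qed.

Lemma mul_inl_inr : mul (braided_tensor X Y) ∘ (inl X Y ⊗ inr X Y) = x ⊗ y.
Proof.
replace (inl X Y ⊗ inr X Y) with ((inl X Y ⊗ (x ⊗ y)) ∘ (x ⊗ inr X Y)).
2:{ rewrite (tensE hC) by hom. now ids. }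
rewrite (compA hC), mul_inl_id by hom.
unfold inr. rewrite (tensA hC), (tensE hC), (mul_oner hX) by hom. now ids.
Qed.

Lemma alg_inl : alg_morphism X (braided_tensor X Y) (inl X Y).
Proof.
split.
- hom.
- replace (inl X Y ⊗ inl X Y) with ((inl X Y ⊗ (x ⊗ y)) ∘ (x ⊗ inl X Y)).
  2:{ rewrite (tensE hC) by hom. now ids. }
  rewrite (compA hC), mul_inl_id by hom.
  unfold inl. rewrite (tensA hC), (tensE hC) by hom.
  rewrite <- (tens1r hC m) at 1. rewrite (tensE hC) by hom. now ids.
- unfold inl. rewrite <- (tens1r hC (one X)) at 1. rewrite (tensE hC) by hom. now ids.
Qed.

Lemma alg_inr : alg_morphism Y (braided_tensor X Y) (inr X Y).
Proof.
split.
- hom.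
- replace (inr X Y ⊗ inr X Y) with (((x ⊗ y) ⊗ inr X Y) ∘ (inr X Y ⊗ y)).
  2:{ rewrite (tensE hC) by hom. now ids. }
  rewrite (compA hC), mul_id_inr by hom.
  unfold inr. rewrite <- (tensA hC (one X)), (tensE hC) by hom.
  rewrite <- (tens1l hC n) at 1. rewrite (tensE hC) by hom. now ids.
- unfold inr. rewrite <- (tens1l hC (one Y)) at 1. rewrite (tensE hC) by hom. now ids.
Qed.

End Two.
#[local] Hint Resolve alg_tens hom_inl hom_inr hom_alg : hom.

Lemma alg_tensm X X' Y Y' f g :
    is_alg X -> is_alg X' -> is_alg Y -> is_alg Y' ->
    alg_morphism X X' f -> alg_morphism Y Y' g ->
  alg_morphism (braided_tensor X Y) (braided_tensor X' Y') (f ⊗ g).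
Proof.
intros hX hX' hY hY' hf hg.
assert (hf' := hom_alg hf). assert (hg' := hom_alg hg).
split; cbn [mul one acar braided_tensor].
- hom.
- replace ((mul X' ⊗ mul Y') ∘ (idm X' ⊗ braid Y' X' ⊗ idm Y') ∘ (f ⊗ g ⊗ (f ⊗ g)))
    with ((mul X' ⊗ mul Y') ∘ ((f ⊗ f ⊗ (g ⊗ g)) ∘ (idm X ⊗ braid Y X ⊗ idm Y))).
  + rewrite !(compA hC) by hom.
    rewrite (tensE hC (f' := f)), (tensE hC (f' := mul X')) by hom.
    now rewrite (alg_mul hf), (alg_mul hg).
  + rewrite <- !(compA hC) by hom. f_equal.
    rewrite (tensA hC (f ⊗ g)), <- (tensA hC f g).
    rewrite (tensA hC (f ⊗ f)), <- (tensA hC f f).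
    rewrite !(tensE hC) by hom.
    rewrite (braid_natE hC hg' hf'). now ids.
- rewrite (tensE hC) by hom. now rewrite (alg_one hf), (alg_one hg).
Qed.

Lemma tensm_inl X X' Y f : is_alg X -> is_alg X' -> is_alg Y -> Hom X X' f ->
  (f ⊗ idm Y) ∘ inl X Y = inl X' Y ∘ f.
Proof.
intros hX hX' hY hf. unfold inl. rewrite <- (tens1r hC f) at 2.
rewrite !(tensE hC) by hom. now ids.
Qed.

Lemma tensm_inr X X' Y f : is_alg X -> is_alg X' -> is_alg Y -> alg_morphism X X' f ->
  (f ⊗ idm Y) ∘ inr X Y = inr X' Y.
Proof.
intros hX hX' hY hf. assert (hf' := hom_alg hf). unfold inr.
rewrite !(tensE hC) by hom. rewrite (alg_one hf). now ids.
Qed.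

Lemma alg_comp X Y Z f g : is_alg X -> is_alg Y -> is_alg Z ->
  alg_morphism X Y f -> alg_morphism Y Z g -> alg_morphism X Z (g ∘ f).
Proof.
intros hX hY hZ hf hg.
assert (hf' := hom_alg hf). assert (hg' := hom_alg hg).
split.
- hom.
- rewrite <- (compA hC), (alg_mul hf), (compA hC), (alg_mul hg) by hom.
  now rewrite <- (tensE hC), (compA hC) by hom.
- now rewrite <- (compA hC), (alg_one hf), (alg_one hg) by hom.
Qed.

Lemma alg_id X : is_alg X -> alg_morphism X X (idm X).
Proof. intros hX; split; try hom; now ids. Qed.

End BraidedTensor.

#[export] Hint Resolve alg_tens hom_inl hom_inr hom_alg : hom.

(** * Convolution along a comodule *)

(* The action on morphisms V -> X of the convolution algebra of morphisms B -> X,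
   for a comodule rho : V -> V ⊗ B. *)
Definition pconv (C : cat_data) (rho : Mor C) (X : alg C) (f g : Mor C) : Mor C :=
  mul X ∘ (f ⊗ g) ∘ rho.

#[export] Hint Resolve hom_cop hom_cou hom_anti bg_alg hom_coact ca_alg
  ca_comodule ca_alg_morphism : hom.

Section Convolution.
Context (C : cat_data) (hC : is_braided_abelian C).
Context (B : bgroup C) (hB : is_braided_group B).
Implicit Types (f g h : Mor C) (X Y : alg C) (V : Ob C).

Definition counit X : Mor C := one X ∘ cou B.

Lemma hom_counit X : is_alg X -> Hom B X (counit X).
Proof. intros hX; unfold counit; hom. Qed.

Lemma self_comodule : is_comodule B B (cop B).
Proof.
split.
- hom.
- apply (cop_assoc hB).
- apply (cou_r hB).
Qed.

Section Coaction.
Context (V : Ob C) (rho : Mor C) (hV : is_comodule B V rho).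
Context (X : alg C) (hX : is_alg X).

Lemma hom_pconv f g : Hom V X f -> Hom B X g -> Hom V X (pconv rho X f g).
Proof. intros; unfold pconv; hom. Qed.

(** Coassociativity of the coaction against associativity of [X]. For [rho = cop B] it is
    associativity of convolution, so the convolution algebra inherits its laws from the comodule
    case. *)
Lemma pconv_assoc f g h : Hom V X f -> Hom B X g -> Hom B X h ->
  pconv rho X (pconv rho X f g) h = pconv rho X f (conv B (mul X) g h).
Proof.
intros hf hg hh; unfold pconv, conv.
replace (mul X ∘ (f ⊗ g) ∘ rho ⊗ h)
  with ((mul X ⊗ idm X) ∘ (f ⊗ g ⊗ h) ∘ (rho ⊗ idm B)).
2:{ rewrite !(tensE hC) by hom. now ids. }
replace (f ⊗ (mul X ∘ (g ⊗ h) ∘ cop B)) with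
  ((idm X ⊗ mul X) ∘ (f ⊗ (g ⊗ h)) ∘ (idm V ⊗ cop B)).
2:{ rewrite !(tensE hC) by hom. now ids. }
rewrite (tensA hC).
rewrite !(compA hC) by hom. rewrite (mul_assoc hX).
rewrite <- (compA hC (f := rho)) by hom. rewrite (coact_cop hV).
now rewrite !(compA hC) by hom.
Qed.

Lemma pconv_counit f : Hom V X f -> pconv rho X f (counit X) = f.
Proof.
intros hf; unfold pconv, counit.
replace (f ⊗ (one X ∘ cou B)) with ((idm X ⊗ one X) ∘ f ∘ (idm V ⊗ cou B)).
- rewrite !(compA hC) by hom. rewrite (mul_oner hX).
  rewrite <- (compA hC (f := rho)) by hom. rewrite (coact_cou hV). now ids.
- rewrite <- (tens1r hC f) at 1. rewrite !(tensE hC) by hom. now ids.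
Qed.

Lemma pconv_post Y phi f g : is_alg Y -> alg_morphism X Y phi ->
    Hom V X f -> Hom B X g ->
  phi ∘ pconv rho X f g = pconv rho Y (phi ∘ f) (phi ∘ g).
Proof.
intros hY hphi hf hg. unfold pconv.
rewrite !(compA hC), (alg_mul hphi) by hom.
rewrite <- (compA hC (f := f ⊗ g)), (tensE hC) by hom. reflexivity.
Qed.

Lemma pconvDl f f' g : Hom V X f -> Hom V X f' -> Hom B X g ->
  pconv rho X (f + f') g = pconv rho X f g + pconv rho X f' g.
Proof.
intros hf hf' hg. unfold pconv.
now rewrite (tensDl hC), (compDr hC), (compDl hC) by hom.
Qed.

Lemma pconvDr f g g' : Hom V X f -> Hom B X g -> Hom B X g' ->
  pconv rho X f (g + g') = pconv rho X f g + pconv rho X f g'.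
Proof.
intros hf hg hg'. unfold pconv.
now rewrite (tensDr hC), (compDr hC), (compDl hC) by hom.
Qed.

Lemma pconvBl f f' g : Hom V X f -> Hom V X f' -> Hom B X g ->
  pconv rho X (f - f') g = pconv rho X f g - pconv rho X f' g.
Proof.
intros hf hf' hg. unfold pconv.
now rewrite (tensBl hC hg), (compBr hC), (compBl hC) by hom.
Qed.

Lemma pconvBr f g g' : Hom V X f -> Hom B X g -> Hom B X g' ->
  pconv rho X f (g - g') = pconv rho X f g - pconv rho X f g'.
Proof.
intros hf hg hg'. unfold pconv.
now rewrite (tensBr hC hf), (compBr hC), (compBl hC) by hom.
Qed.

End Coaction.

Section Algebra.
Context (X : alg C) (hX : is_alg X).
Local Notation "f * g" := (conv B (mul X) f g) : mor_scope.

Lemma hom_conv f g : Hom B X f -> Hom B X g -> Hom B X (f * g).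
Proof. exact (hom_pconv self_comodule hX (f := f) (g := g)). Qed.

Lemma convA f g h : Hom B X f -> Hom B X g -> Hom B X h -> f * (g * h) = f * g * h.
Proof. symmetry. now apply (pconv_assoc self_comodule hX). Qed.

Lemma conv1r f : Hom B X f -> f * counit X = f.
Proof. exact (pconv_counit self_comodule hX (f := f)). Qed.

Lemma conv1l f : Hom B X f -> counit X * f = f.
Proof.
intros hf; unfold conv, counit.
replace ((one X ∘ cou B) ⊗ f) with ((one X ⊗ idm X) ∘ f ∘ (cou B ⊗ idm B)).
- rewrite !(compA hC) by hom. rewrite (mul_onel hX).
  rewrite <- (compA hC (f := cop B)) by hom. rewrite (cou_l hB). now ids.
- rewrite <- (tens1l hC f) at 1. rewrite !(tensE hC) by hom. now ids.
Qed.

Lemma conv_post Y phi f g : is_alg Y -> alg_morphism X Y phi ->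
    Hom B X f -> Hom B X g ->
  phi ∘ (f * g) = conv B (mul Y) (phi ∘ f) (phi ∘ g).
Proof. exact (pconv_post self_comodule hX (f := f) (g := g)). Qed.

Lemma counit_post Y phi : is_alg Y -> alg_morphism X Y phi ->
  phi ∘ counit X = counit Y.
Proof.
intros hY hphi. unfold counit. now rewrite (compA hC), (alg_one hphi) by hom.
Qed.

Lemma convDl f f' g : Hom B X f -> Hom B X f' -> Hom B X g ->
  (f + f') * g = f * g + f' * g.
Proof. exact (pconvDl self_comodule hX (f := f) (f' := f') (g := g)). Qed.

Lemma convDr f g g' : Hom B X f -> Hom B X g -> Hom B X g' ->
  f * (g + g') = f * g + f * g'.
Proof. exact (pconvDr self_comodule hX (f := f) (g := g) (g' := g')). Qed.

Lemma convBl f f' g : Hom B X f -> Hom B X f' -> Hom B X g ->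
  (f - f') * g = f * g - f' * g.
Proof. exact (pconvBl self_comodule hX (f := f) (f' := f') (g := g)). Qed.

Lemma convBr f g g' : Hom B X f -> Hom B X g -> Hom B X g' ->
  f * (g - g') = f * g - f * g'.
Proof. exact (pconvBr self_comodule hX (f := f) (g := g) (g' := g')). Qed.

(** Since [cop B] preserves the unit, evaluation at the unit of [B] is multiplicative; this carries
    the condition of vanishing at the unit through the gauge formulas. *)
Lemma conv_one f g : Hom B X f -> Hom B X g ->
  (f * g) ∘ one B = mul X ∘ ((f ∘ one B) ⊗ (g ∘ one B)).
Proof.
intros hf hg. unfold conv.
assert (e := alg_one (cop_alg hB)). cbn [one braided_tensor] in e.
rewrite <- (compA hC), e, <- (compA hC), (tensE hC) by hom. reflexivity.
Qed.

Lemma counit_one : counit X ∘ one B = one X.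
Proof.
unfold counit. assert (e := alg_one (cou_alg hB)). cbn [one unit_alg] in e.
rewrite <- (compA hC), e by hom. now ids.
Qed.

Lemma conv_one_l f g : Hom B X f -> Hom B X g -> f ∘ one B = one X ->
  (f * g) ∘ one B = g ∘ one B.
Proof.
intros hf hg e. rewrite conv_one, e by hom.
replace (one X ⊗ (g ∘ one B)) with ((one X ⊗ idm X) ∘ (g ∘ one B)).
- rewrite (compA hC), (mul_onel hX) by hom. now ids.
- rewrite <- (tens1l hC (g ∘ one B)) at 1. rewrite (tensE hC) by hom. now ids.
Qed.

Lemma conv_one_r f g : Hom B X f -> Hom B X g -> g ∘ one B = one X ->
  (f * g) ∘ one B = f ∘ one B.
Proof.
intros hf hg e. rewrite conv_one, e by hom.
replace (f ∘ one B ⊗ one X) with ((idm X ⊗ one X) ∘ (f ∘ one B)).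
- rewrite (compA hC), (mul_oner hX) by hom. now ids.
- rewrite <- (tens1r hC (f ∘ one B)) at 1. rewrite (tensE hC) by hom. now ids.
Qed.

Lemma convK f f' g : conv_inverse B X f f' -> Hom B X f -> Hom B X f' -> Hom B X g ->
  f * (f' * g) = g.
Proof.
intros [e _] hf hf' hg. rewrite convA by hom. fold (counit X) in e. rewrite e. now apply conv1l.
Qed.

Lemma convKr f f' g : conv_inverse B X f f' -> Hom B X f -> Hom B X f' -> Hom B X g ->
  g * f * f' = g.
Proof.
intros [e _] hf hf' hg. rewrite <- convA by hom. fold (counit X) in e. rewrite e. now apply conv1r.
Qed.

Lemma conv_inverse_post Y phi f f' : is_alg Y -> alg_morphism X Y phi ->
    Hom B X f -> Hom B X f' -> conv_inverse B X f f' ->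
  conv_inverse B Y (phi ∘ f) (phi ∘ f').
Proof.
intros hY hphi hf hf' [e e']. fold (counit X) in e, e'.
split; rewrite <- (conv_post hY hphi) by hom;
  [rewrite e | rewrite e']; now apply counit_post.
Qed.

Lemma conv_inverseC f f' : conv_inverse B X f f' -> conv_inverse B X f' f.
Proof. now intros []. Qed.

Lemma conv_inverse_unique f g g' : Hom B X f -> Hom B X g -> Hom B X g' ->
  g * f = counit X -> f * g' = counit X -> g = g'.
Proof.
intros hf hg hg' e e'.
now rewrite <- (conv1r hg), <- e', convA, e, conv1l by hom.
Qed.

End Algebra.
End Convolution.

Arguments counit {C} B X.
#[export] Hint Resolve hom_counit self_comodule : hom.
#[export] Hint Extern 1 (Hom _ _ (conv _ (mul _) _ _)) =>
  eapply hom_conv; [eassumption | solve [eauto with hom] ..| hom | hom] : hom.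
#[export] Hint Extern 1 (Hom _ _ (pconv _ _ _ _)) =>
  eapply hom_pconv; [eassumption | solve [eauto with hom] ..| hom | hom] : hom.

(** * Morphisms out of [P ⊗ P] given by two algebra morphisms *)

Definition bracket (C : cat_data) (X : alg C) (al be : Mor C) : Mor C := mul X ∘ (al ⊗ be).

Section Bracket.
Context (C : cat_data) (hC : is_braided_abelian C).
Context (B : bgroup C) (hB : is_braided_group B).
Implicit Types (f g h F : Mor C) (X Y : alg C) (V : Ob C).

Section Tensor.
Context (X Y : alg C) (hX : is_alg X) (hY : is_alg Y).
Context (V : Ob C) (rho : Mor C).

(** Rewrites the left action on the first tensor factor as a product in the braided tensor algebra,
    so that bimodule operations obey the laws of convolution. *)
Lemma pconv_inl f F : Hom V X f -> Hom B (X ⊗ Y) F ->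
  pconv rho (braided_tensor X Y) (inl X Y ∘ f) F = (mul X ⊗ idm Y) ∘ (f ⊗ F) ∘ rho.
Proof.
intros hf hF. unfold pconv. rewrite <- (mul_inl_id hC hX hY). f_equal.
rewrite <- (compA hC), (tensE hC) by hom. now ids.
Qed.

Lemma pconv_inr F g : Hom V (X ⊗ Y) F -> Hom B Y g ->
  pconv rho (braided_tensor X Y) F (inr X Y ∘ g) = (idm X ⊗ mul Y) ∘ (F ⊗ g) ∘ rho.
Proof.
intros hf hF. unfold pconv. rewrite <- (mul_id_inr hC hX hY). f_equal.
rewrite <- (compA hC), (tensE hC) by hom. now ids.
Qed.

Lemma pconv_inl_inr f g : Hom V X f -> Hom B Y g ->
  pconv rho (braided_tensor X Y) (inl X Y ∘ f) (inr X Y ∘ g) = (f ⊗ g) ∘ rho.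
Proof.
intros hf hF. unfold pconv. f_equal.
rewrite <- (tensE hC), (compA hC), (mul_inl_inr hC hX hY) by hom. now ids.
Qed.

End Tensor.

Context (P X : alg C) (hP : is_alg P) (hX : is_alg X).
Context (al be : Mor C) (hal : alg_morphism P X al) (hbe : alg_morphism P X be).
Let hal' := hom_alg hal.
Let hbe' := hom_alg hbe.

Lemma hom_bracket : Hom (P ⊗ P) X (bracket X al be).
Proof. unfold bracket; hom. Qed.
Local Hint Resolve hom_bracket : hom.

(** A bracket is not assumed multiplicative, but multiplicativity of [al] and associativity of [X]
    make it respect left products by the first leg. Both [chi] and the tensor product coaction are
    brackets. *)
Lemma bracket_conv_inl f F : Hom B P f -> Hom B (P ⊗ P) F ->
  bracket X al be ∘ conv B (mul (braided_tensor P P)) (inl P P ∘ f) F =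
  conv B (mul X) (al ∘ f) (bracket X al be ∘ F).
Proof.
intros hf hF.
change (conv B (mul (braided_tensor P P)) (inl P P ∘ f) F)
  with (pconv (cop B) (braided_tensor P P) (inl P P ∘ f) F).
rewrite (pconv_inl hP hP (V := B)) by hom. unfold conv.
rewrite !(compA hC) by hom. f_equal.
rewrite <- (tensE hC), (compA hC) by hom. f_equal.
unfold bracket. rewrite <- (compA hC), (tensE hC), (alg_mul hal) by hom.
replace (mul X ∘ (al ⊗ al) ⊗ (be ∘ idm P)) with ((mul X ⊗ idm X) ∘ (al ⊗ al ⊗ be)).
2:{ rewrite (tensE hC) by hom. now ids. }
rewrite (compA hC), (mul_assoc hX) by hom.
rewrite <- (compA hC), <- (tensA hC), (tensE hC) by hom. now ids.
Qed.

Lemma bracket_conv_inr F g : Hom B (P ⊗ P) F -> Hom B P g ->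
  bracket X al be ∘ conv B (mul (braided_tensor P P)) F (inr P P ∘ g) =
  conv B (mul X) (bracket X al be ∘ F) (be ∘ g).
Proof.
intros hF hg.
change (conv B (mul (braided_tensor P P)) F (inr P P ∘ g))
  with (pconv (cop B) (braided_tensor P P) F (inr P P ∘ g)).
rewrite (pconv_inr hP hP (V := B)) by hom. unfold conv.
rewrite !(compA hC) by hom. f_equal.
rewrite <- (tensE hC), (compA hC) by hom. f_equal.
unfold bracket. rewrite <- (compA hC), (tensE hC), (alg_mul hbe) by hom.
replace ((al ∘ idm P) ⊗ (mul X ∘ (be ⊗ be))) with ((idm X ⊗ mul X) ∘ (al ⊗ (be ⊗ be))).
2:{ rewrite (tensE hC) by hom. now ids. }
rewrite (compA hC), <- (mul_assoc hX) by hom.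
rewrite <- (compA hC), (tensA hC), (tensE hC) by hom. now ids.
Qed.

Lemma bracket_inl : bracket X al be ∘ inl P P = al.
Proof.
unfold bracket, inl. rewrite <- (compA hC), (tensE hC), (alg_one hbe) by hom. ids.
replace (al ⊗ one X) with ((idm X ⊗ one X) ∘ al).
- rewrite (compA hC), (mul_oner hX) by hom. now ids.
- rewrite <- (tens1r hC al) at 1. rewrite (tensE hC) by hom. now ids.
Qed.

Lemma bracket_inr : bracket X al be ∘ inr P P = be.
Proof.
unfold bracket, inr. rewrite <- (compA hC), (tensE hC), (alg_one hal) by hom. ids.
replace (one X ⊗ be) with ((one X ⊗ idm X) ∘ be).
- rewrite (compA hC), (mul_onel hX) by hom. now ids.
- rewrite <- (tens1l hC be) at 1. rewrite (tensE hC) by hom. now ids.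
Qed.

(** The unit of the convolution algebra factors through the first leg, where the bracket is the
    algebra morphism [al]. *)
Lemma bracket_counit : bracket X al be ∘ counit B (braided_tensor P P) = counit B X.
Proof.
replace (counit B (braided_tensor P P)) with (inl P P ∘ counit B P).
- rewrite (compA hC), bracket_inl by hom. now apply (counit_post hC hB).
- apply (counit_post hC hB); try hom; auto with hom. now apply alg_inl.
Qed.

Lemma bracket_gauge f F g : Hom B P f -> Hom B (P ⊗ P) F -> Hom B P g ->
  bracket X al be ∘ conv B (mul (braided_tensor P P))
    (conv B (mul (braided_tensor P P)) (inl P P ∘ f) F) (inr P P ∘ g) =
  conv B (mul X) (conv B (mul X) (al ∘ f) (bracket X al be ∘ F)) (be ∘ g).
Proof.
intros hf hF hg. rewrite bracket_conv_inr by hom. now rewrite bracket_conv_inl by hom.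
Qed.

End Bracket.
#[export] Hint Resolve hom_bracket : hom.

(** * Trivial bundles *)

Section Bundle.
Context (C : cat_data) (hC : is_braided_abelian C).
Context (B : bgroup C) (hB : is_braided_group B).
Context (P : tbundle C) (hP : is_trivial_bundle B P).
Implicit Types (f g h F : Mor C).

Local Notation Q := (braided_tensor P P).
Local Notation R := (braided_tensor P B).
Local Notation E := (braided_tensor Q B).
Local Notation "f *[ X ] g" := (conv B (mul X) f g)
  (at level 40, left associativity, format "f  *[ X ]  g") : mor_scope.
Local Notation "f ⋆[ X ] g" := (pconv (coact P) X f g)
  (at level 40, left associativity, format "f  ⋆[ X ]  g") : mor_scope.
Local Notation a1 := (inl P P).
Local Notation a2 := (inr P P).
Local Notation rho := (coact P).
Local Notation i := (incl P).
Local Notation M := (dom (incl P)).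
Local Notation phi := (triv P).
Local Notation phi' := (triv_inv P).

Let hBa : is_alg B := bg_alg hB.
Let hPa : is_alg P := ca_alg (tb_comodule_algebra hP).
Let hrho : is_comodule B P rho := ca_comodule (tb_comodule_algebra hP).
Let hrhoa : alg_morphism P R rho := ca_alg_morphism (tb_comodule_algebra hP).
Let hQ : is_alg Q := alg_tens hC hPa hPa.
Let hR : is_alg R := alg_tens hC hPa hBa.
Let hE : is_alg E := alg_tens hC hQ hBa.
Let hrho' : Hom P (P ⊗ B) rho := hom_coact hrho.
Let hphi : Hom B P phi := hom_triv hP.
Let hphi' : Hom B P phi' := hom_triv_inv hP.
Let hphiV := triv_convV hP.
Let ha1 : alg_morphism P Q a1 := alg_inl hC hPa hPa.
Let ha2 : alg_morphism P Q a2 := alg_inr hC hPa hPa.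
Let hinlB : alg_morphism P R (inl P B) := alg_inl hC hPa hBa.
Let hinrB : alg_morphism B R (inr P B) := alg_inr hC hPa hBa.
Let hinlE : alg_morphism Q E (inl Q B) := alg_inl hC hQ hBa.
Let hinrE : alg_morphism B E (inr Q B) := alg_inr hC hQ hBa.
Let hi : Hom M P i.
Proof.
generalize (hom_equaliser (tb_base hP)). now rewrite (hom_dom hrho').
Qed.

(** Evaluate [Φ * Φ⁻¹ = η ∘ ε] at the unit, where [Φ] is already normalised. *)
Lemma triv_inv_one : phi' ∘ one B = one P.
Proof.
rewrite <- (conv_one_l hC hB hPa hphi hphi') by apply (triv_one hP).
rewrite (proj1 hphiV). apply (counit_one hC hB hPa).
Qed.

(** Writes [p₀ ⊗ p₁] as a product of its two legs in [R], so that the coaction can be handled inside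
    convolution products. *)
Lemma coact_conv : inl P B ⋆[R] inr P B = rho.
Proof.
generalize (pconv_inl_inr hC hPa hBa rho (hom_idE hC P) (hom_idE hC B)).
now ids.
Qed.

Lemma coact_triv : rho ∘ phi = (inl P B ∘ phi) *[R] inr P B.
Proof.
rewrite (triv_coact hP).
generalize (pconv_inl_inr hC hPa hBa (cop B) hphi (hom_idE hC B)).
now ids.
Qed.

Lemma anti_conv_inverse X b : is_alg X -> alg_morphism B X b ->
  conv_inverse B X b (b ∘ anti B).
Proof.
intros hX hb.
assert (h := conv_inverse_post hC hB hBa hX hb (hom_idE hC B) (hom_anti hB) (anti_inv hB)).
assert (hb' := hom_alg hb).
now rewrite (comp1r hC) in h by hom.
Qed.

(* Both sides are the convolution inverse of [rho ∘ phi]. *)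
Lemma coact_triv_inv : rho ∘ phi' = (inr P B ∘ anti B) *[R] (inl P B ∘ phi').
Proof.
apply (conv_inverse_unique hC hB hR (f := rho ∘ phi)); try hom.
- apply (conv_inverse_post hC hB hPa hR hrhoa hphi hphi' hphiV).
- rewrite coact_triv, (convA hC hB hR) by hom.
  rewrite (convKr hC hB hR (anti_conv_inverse hR hinrB)) by hom.
  apply (conv_inverse_post hC hB hPa hR hinlB hphi hphi' hphiV).
Qed.

(** [coact1] and [coact2] are the morphisms λ and μ into [E]: the coaction of [P] with its [P]-part
    placed in the first or in the second leg of [Q]. *)
Definition coact1 : Mor C := (a1 ⊗ idm B) ∘ rho.
Definition coact2 : Mor C := (a2 ⊗ idm B) ∘ rho.

Lemma alg_coact1 : alg_morphism P E coact1.
Proof.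
apply (alg_comp hC hPa hR hE hrhoa).
apply (alg_tensm hC); auto. now apply alg_id.
Qed.

Lemma alg_coact2 : alg_morphism P E coact2.
Proof.
apply (alg_comp hC hPa hR hE hrhoa).
apply (alg_tensm hC); auto. now apply alg_id.
Qed.
Let hc1 := alg_coact1.
Let hc2 := alg_coact2.

Lemma coact1_triv_inv :
  coact1 ∘ phi' = (inr Q B ∘ anti B) *[E] (inl Q B ∘ (a1 ∘ phi')).
Proof.
unfold coact1. rewrite <- (compA hC) by hom. rewrite coact_triv_inv.
rewrite (conv_post hC hB hR hE) by (hom || apply (alg_tensm hC); auto; now apply alg_id).
rewrite !(compA hC) by hom.
now rewrite (tensm_inr hC hPa hQ hBa ha1), (tensm_inl hC hPa hQ hBa) by hom.
Qed.

Lemma coact1_triv : coact1 ∘ phi = (inl Q B ∘ (a1 ∘ phi)) *[E] inr Q B.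
Proof.
unfold coact1. rewrite <- (compA hC) by hom. rewrite coact_triv.
rewrite (conv_post hC hB hR hE) by (hom || apply (alg_tensm hC); auto; now apply alg_id).
rewrite !(compA hC) by hom.
now rewrite (tensm_inr hC hPa hQ hBa ha1), (tensm_inl hC hPa hQ hBa) by hom.
Qed.

Lemma coact2_triv : coact2 ∘ phi = (inl Q B ∘ (a2 ∘ phi)) *[E] inr Q B.
Proof.
unfold coact2. rewrite <- (compA hC) by hom. rewrite coact_triv.
rewrite (conv_post hC hB hR hE) by (hom || apply (alg_tensm hC); auto; now apply alg_id).
rewrite !(compA hC) by hom.
now rewrite (tensm_inr hC hPa hQ hBa ha2), (tensm_inl hC hPa hQ hBa) by hom.
Qed.

Lemma coact2_triv_inv :
  coact2 ∘ phi' = (inr Q B ∘ anti B) *[E] (inl Q B ∘ (a2 ∘ phi')).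
Proof.
unfold coact2. rewrite <- (compA hC) by hom. rewrite coact_triv_inv.
rewrite (conv_post hC hB hR hE) by (hom || apply (alg_tensm hC); auto; now apply alg_id).
rewrite !(compA hC) by hom.
now rewrite (tensm_inr hC hPa hQ hBa ha2), (tensm_inl hC hPa hQ hBa) by hom.
Qed.

(** * The tensor product and adjoint coactions as convolution products *)

Lemma tens_coact_bracket : tens_coact B P rho P rho = bracket E coact1 coact2.
Proof.
unfold bracket, coact1, coact2, tens_coact.
rewrite <- (tensE hC), (compA hC) by hom. f_equal.
change (mul E) with ((mul Q ⊗ mul B) ∘ (idm (P ⊗ P) ⊗ braid B (P ⊗ P) ⊗ idm B)).
rewrite <- (compA hC) by hom.
replace ((idm (P ⊗ P) ⊗ braid B (P ⊗ P) ⊗ idm B) ∘ ((a1 ⊗ idm B) ⊗ (a2 ⊗ idm B)))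
  with ((a1 ⊗ a2 ⊗ (idm B ⊗ idm B)) ∘ (idm P ⊗ braid B P ⊗ idm B)).
- rewrite (compA hC), (tensE hC (f' := mul Q)), (mul_inl_inr hC hPa hPa) by hom. now ids.
- rewrite (tensA hC (a1 ⊗ a2)), (tensA hC (a1 ⊗ idm B)).
  rewrite <- (tensA hC a1 a2), <- (tensA hC a1 (idm B)).
  rewrite (tensE hC (g' := idm B)), (tensE hC (f' := a1)) by hom.
  rewrite (tensE hC (g' := idm B)), (tensE hC (f' := idm (P ⊗ P))) by hom.
  (* Naturality along [a2] reduces the braiding of [B] past [P ⊗ P] to that of [B] past the second
     copy of [P]. *)
  rewrite (braid_natE hC (hom_idE hC B) (hom_inr hC P hPa)). now ids.
Qed.

(** The last two factors multiply to [(F ⊗ id) ∘ Δ]. Multiplying by the antipode from the left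
    braids it past [F], and naturality turns this into the braiding of [B] with itself inside
    [Ad]. *)
Lemma tens_Ad F : Hom B (P ⊗ P) F ->
  (F ⊗ idm B) ∘ Ad B = (inr Q B ∘ anti B) *[E] (inl Q B ∘ F) *[E] inr Q B.
Proof.
intros hF.
rewrite <- (convA hC hB hE) by hom.
assert (e := pconv_inl_inr hC hQ hBa (cop B) hF (hom_idE hC B)).
rewrite (comp1r hC) in e by hom. unfold pconv in e.
unfold conv at 2. rewrite e. unfold conv, Ad.
replace (inr Q B ∘ anti B ⊗ ((F ⊗ idm B) ∘ cop B))
  with ((inr Q B ⊗ (idm Q ⊗ idm B)) ∘ (idm B ⊗ (F ⊗ idm B)) ∘ (anti B ⊗ cop B)).
2:{ rewrite !(tensE hC) by hom. now ids. }
rewrite !(compA hC) by hom. do 2 f_equal.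
rewrite (mul_inr_id hC hQ hBa).
rewrite <- (compA hC (f := idm B ⊗ (F ⊗ idm B))), (tensA hC (idm B)) by hom.
rewrite (tensE hC (f' := braid B Q)) by hom.
rewrite (braid_natE (Y' := Q) hC (hom_idE hC B) hF).
replace ((F ⊗ idm B) ∘ braid B B ⊗ (idm B ∘ idm B))
  with ((F ⊗ (idm B ⊗ idm B)) ∘ (braid B B ⊗ idm B)).
2:{ rewrite (tensA hC), (tensE hC) by hom. now ids. }
rewrite !(compA hC) by hom. f_equal.
rewrite !(tensE hC) by hom. now ids.
Qed.

(** The coaction of [Φ⁻¹] contributes the antipode on the far left and that of [Φ] an identity of
    [B] on the far right; the coinvariant [F] contributes nothing, and the result is the product in
    [tens_Ad]. *)
Lemma coact_gauge F : Hom B (P ⊗ P) F ->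
  tens_coact B P rho P rho ∘ F = inl Q B ∘ F ->
  tens_coact B P rho P rho ∘ (a1 ∘ phi' *[Q] F *[Q] (a2 ∘ phi)) =
  (a1 ∘ phi' *[Q] F *[Q] (a2 ∘ phi) ⊗ idm B) ∘ Ad B.
Proof.
intros hF e. rewrite tens_Ad by hom.
rewrite tens_coact_bracket in *.
rewrite (bracket_gauge hC hB hPa hE hc1 hc2 hphi' hF hphi).
rewrite e, coact1_triv_inv, coact2_triv.
rewrite !(conv_post hC hB hQ hE hinlE) by hom.
rewrite !(convA hC hB hE) by hom. reflexivity.
Qed.

(** Now [Φ] and [Φ⁻¹] put [id * S] on either side of [F], and both pairs cancel. *)
Lemma coact_gauge_inv F : Hom B (P ⊗ P) F ->
  tens_coact B P rho P rho ∘ F = (F ⊗ idm B) ∘ Ad B ->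
  tens_coact B P rho P rho ∘ (a1 ∘ phi *[Q] F *[Q] (a2 ∘ phi')) =
  inl Q B ∘ (a1 ∘ phi *[Q] F *[Q] (a2 ∘ phi')).
Proof.
intros hF e. rewrite tens_Ad in e by hom.
rewrite tens_coact_bracket in *.
rewrite (bracket_gauge hC hB hPa hE hc1 hc2 hphi hF hphi').
rewrite e, coact1_triv, coact2_triv_inv.
rewrite !(conv_post hC hB hQ hE hinlE) by hom.
rewrite !(convA hC hB hE) by hom.
rewrite !(convKr hC hB hE (anti_conv_inverse hE hinrE)) by hom.
reflexivity.
Qed.

Lemma chi_bracket : chi B P = bracket R (inl P B) rho.
Proof.
unfold chi, bracket. rewrite <- (mul_inl_id hC hPa hBa).
rewrite <- (compA hC), (tensE hC) by hom. now ids.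
Qed.

(* p ↦ p₀ Φ⁻¹(p₁), which takes values in M and satisfies p = s(p₀) Φ(p₁). *)
Definition base_part : Mor C := idm P ⋆[P] phi'.

Lemma hom_base_part : Hom P P base_part.
Proof. unfold base_part. hom. Qed.

(** The coaction gives [p₀ · p₁ · S(p₂) · Φ⁻¹(p₃)] in [R], and the middle pair cancels. *)
Lemma coact_base_part : rho ∘ base_part = inl P B ∘ base_part.
Proof.
unfold base_part.
rewrite (pconv_post hC hrho hPa hR hrhoa), (pconv_post hC hrho hPa hR hinlB) by hom.
ids. rewrite <- coact_conv at 2. rewrite coact_triv_inv.
rewrite (pconv_assoc hC hB hrho hR) by hom.
now rewrite (convK hC hB hR (anti_conv_inverse hR hinrB)) by hom.
Qed.

Lemma base_part_triv : base_part ⋆[P] phi = idm P.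
Proof.
unfold base_part. rewrite (pconv_assoc hC hB hrho hPa) by hom.
rewrite (proj2 hphiV). apply (pconv_counit hC hB hrho hPa); hom.
Qed.

(** * The base [M] and the subobjects [M ⊗ P] and [M ⊗ M] of [P ⊗ P] *)

Lemma coact_incl : rho ∘ i = inl P B ∘ i.
Proof. apply (eq_comm (tb_base hP)). Qed.

Lemma incl_lift X f : Hom X P f -> rho ∘ f = inl P B ∘ f ->
  exists u, Hom X M u /\ i ∘ u = f.
Proof.
intros hf e. rewrite <- (hom_dom hf). apply (equaliser_lift (tb_base hP)); auto.
rewrite (hom_dom hrho'). hom.
Qed.

Lemma incl_factor X f : Hom X P f -> rho ∘ f = inl P B ∘ f ->
  Hom X M (factor i f) /\ i ∘ factor i f = f.
Proof.
intros hf e. rewrite <- (hom_dom hf) at 1. apply factorP.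
rewrite (hom_dom hf). now apply incl_lift.
Qed.

(** Both arrows of the equaliser are algebra morphisms, so [M] is closed under products and the
    choice made in [sub_alg] is a genuine restriction. *)
Lemma base_mul : Hom (M ⊗ M) M (mul (base P)) /\ i ∘ mul (base P) = mul P ∘ (i ⊗ i).
Proof.
apply incl_factor.
- hom.
- rewrite !(compA hC), (alg_mul hrhoa), (alg_mul hinlB) by hom.
  rewrite <- !(compA hC), !(tensE hC) by hom. now rewrite coact_incl.
Qed.

Lemma base_one : Hom unitO M (one (base P)) /\ i ∘ one (base P) = one P.
Proof.
apply incl_factor.
- hom.
- now rewrite (alg_one hrhoa), (alg_one hinlB).
Qed.

Let hmM := proj1 base_mul.
Let honeM := proj1 base_one.

Lemma incl_mono : mono i.
Proof. apply (equaliser_mono hC (tb_base hP)). Qed.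

Lemma incl_tens_equaliser X :
  is_equaliser (i ⊗ idm X) (rho ⊗ idm X) (inl P B ⊗ idm X).
Proof. apply (tens_eqr (ba_compatible hC)), (tb_base hP). Qed.

Lemma tens_incl_equaliser X :
  is_equaliser (idm X ⊗ i) (idm X ⊗ rho) (idm X ⊗ inl P B).
Proof. apply (tens_eql (ba_compatible hC)), (tb_base hP). Qed.

(** The tensor product preserves equalisers, so [i ⊗ i] is a composite of two of them. *)
Lemma incl2_mono : mono (i ⊗ i).
Proof.
replace (i ⊗ i) with ((i ⊗ idm P) ∘ (idm M ⊗ i)).
2:{ rewrite (tensE hC) by hom. now ids. }
apply (mono_comp hC) with (M ⊗ M)%ob (M ⊗ P)%ob.
- hom.
- apply (equaliser_mono hC (tens_incl_equaliser M)).
- apply (equaliser_mono hC (incl_tens_equaliser P)).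
- hom.
Qed.

(* [F] takes values in M ⊗ P. *)
Definition left_based F : Prop := (rho ⊗ idm P) ∘ F = (inl P B ⊗ idm P) ∘ F.

Lemma left_based_comp X Y F f : Hom X Y f -> Hom Y (P ⊗ P) F ->
  left_based F -> left_based (F ∘ f).
Proof.
unfold left_based; intros hf hF e. rewrite !(compA hC) by hom. now rewrite e.
Qed.

Lemma left_based_mulr X Y F g : Hom X (P ⊗ P) F -> Hom Y P g ->
  left_based F -> left_based ((idm P ⊗ mul P) ∘ (F ⊗ g)).
Proof.
unfold left_based; intros hF hg e. rewrite !(compA hC) by hom.
assert (h : forall r, Hom P (P ⊗ B) r -> (r ⊗ idm P) ∘ (idm P ⊗ mul P) ∘ (F ⊗ g)
   = (idm (P ⊗ B) ⊗ mul P) ∘ ((r ⊗ idm P) ∘ F ⊗ g)).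
{ intros r hr.
  replace ((r ⊗ idm P) ∘ F ⊗ g) with (((r ⊗ idm P) ⊗ idm P) ∘ (F ⊗ g)).
  2:{ rewrite (tensE hC) by hom. now ids. }
  rewrite (compA hC) by hom. f_equal.
  rewrite <- (tensA hC r), !(tensE hC) by hom. now ids. }
now rewrite !h, e by hom.
Qed.

Lemma left_based_inr : left_based a2.
Proof.
unfold left_based, inr. rewrite !(tensE hC) by hom.
now rewrite (alg_one hrhoa), (alg_one hinlB).
Qed.

Lemma left_based_incl2 : left_based (i ⊗ i).
Proof.
unfold left_based. rewrite !(tensE hC) by hom. now rewrite coact_incl.
Qed.

(** The bracket sees the first factor only through [rho], which may be replaced by [inl P B]; the
    product in [E] then has its left factor in the first leg and needs no braiding. *)
Lemma coact_left_based X F : Hom X (P ⊗ P) F -> left_based F ->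
  tens_coact B P rho P rho ∘ F = (idm P ⊗ rho) ∘ F.
Proof.
unfold left_based. intros hF e. rewrite tens_coact_bracket.
assert (h : bracket E coact1 coact2 =
  mul E ∘ ((a1 ⊗ idm B) ⊗ coact2) ∘ (rho ⊗ idm P)).
{ unfold bracket. rewrite <- (compA hC), (tensE hC) by hom. now ids. }
rewrite h, <- (compA hC), e, !(compA hC) by hom. f_equal.
rewrite <- (compA hC), (tensE hC), (tensm_inl hC hPa hQ hBa) by hom. ids.
unfold coact2.
replace (inl Q B ∘ a1 ⊗ ((a2 ⊗ idm B) ∘ rho))
  with ((inl Q B ⊗ (idm Q ⊗ idm B)) ∘ (a1 ⊗ (a2 ⊗ idm B)) ∘ (idm P ⊗ rho)).
2:{ rewrite !(tensE hC) by hom. now ids. }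
rewrite !(compA hC) by hom. rewrite (mul_inl_id hC hQ hBa).
rewrite (tensA hC), (tensE hC), (mul_inl_inr hC hPa hPa) by hom. now ids.
Qed.

(** The first factor is lifted to [M] by the hypothesis on [F], the second by coinvariance, which on
    [M ⊗ P] concerns the second factor alone. *)
Lemma incl2_lift X F : Hom X (P ⊗ P) F -> left_based F ->
  tens_coact B P rho P rho ∘ F = inl Q B ∘ F ->
  exists G, Hom X (M ⊗ M) G /\ (i ⊗ i) ∘ G = F.
Proof.
intros hF e e'. rewrite (coact_left_based hF e) in e'.
destruct (equaliser_lift (h := F) (incl_tens_equaliser P)) as [G [hG E]]; [hom|exact e|].
assert (hG' : Hom X (M ⊗ P) G) by (eapply hom_eq; [exact hG|hom|hom]).
destruct (equaliser_lift (h := G) (tens_incl_equaliser M)) as [H [hH E']].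
- hom.
(* The equaliser condition on [G] is tested after the monomorphism [i ⊗ id]; [r] stands for either
   of the two arrows. *)
- assert (h : forall r, Hom P (P ⊗ B) r -> (i ⊗ idm (P ⊗ B)) ∘ ((idm M ⊗ r) ∘ G) =
    (idm P ⊗ r) ∘ ((i ⊗ idm P) ∘ G)).
  { intros r hr. rewrite !(compA hC) by hom. f_equal.
    rewrite !(tensE hC) by hom. now ids. }
  eapply (mono_eq (X := X) (equaliser_mono hC (incl_tens_equaliser (P ⊗ B))));
    [hom|hom|hom|].
  rewrite !h, E, e' by hom. f_equal. unfold inl.
  rewrite (tensA hC). now ids.
- exists H. split.
  + eapply hom_eq; [exact hH|hom|hom].
  + assert (hH' : Hom X (M ⊗ M) H) by (eapply hom_eq; [exact hH|hom|hom]).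
    rewrite <- E, <- E', (compA hC), (tensE hC) by hom. now ids.
Qed.

Lemma coact_incl2 : tens_coact B P rho P rho ∘ (i ⊗ i) = inl Q B ∘ (i ⊗ i).
Proof.
rewrite (coact_left_based (X := (M ⊗ M)%ob)) by (hom || exact left_based_incl2).
rewrite (tensE hC), coact_incl by hom. unfold inl.
rewrite (idm_tens hC), <- (tensA hC), (tensE hC) by hom. now ids.
Qed.

(** On [M ⊗ M] the coaction is trivial and [chi] reduces to the product, so it kills the 1-forms of
    [M]. *)
Lemma chi_incl2 : chi B P ∘ (i ⊗ i) = inl P B ∘ (mul P ∘ (i ⊗ i)).
Proof.
rewrite chi_bracket. unfold bracket.
rewrite <- (compA hC), (tensE hC), coact_incl by hom.
rewrite (compA hC), (alg_mul hinlB), <- (compA hC), (tensE hC) by hom. reflexivity.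
Qed.

(** * Connections and gauge forms *)

Section Forms.
Context (jP : Mor C) (hjP : is_kernel jP (mul P)).
Context (jM : Mor C) (hjM : is_kernel jM (mul (base P))).
Local Notation W := (dom jP).
Local Notation tc := (tens_coact B P rho P rho).
Local Notation u := (counit B Q).

Let hj : Hom W (P ⊗ P) jP.
Proof. generalize (hom_equaliser hjP). now rewrite (hom_dom (hom_mul hPa)). Qed.
Let hjm : Hom (dom jM) (M ⊗ M) jM.
Proof. generalize (hom_equaliser hjM). now rewrite (hom_dom hmM). Qed.
Let hjmono : mono jP := equaliser_mono hC hjP.
Let mul_jP : mul P ∘ jP = zerom W P := kernel_comp hC hjP (hom_mul hPa).
Let htc : Hom (P ⊗ P) (P ⊗ P ⊗ B) tc.
Proof. rewrite tens_coact_bracket. hom. Qed.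
Let hu : Hom B (P ⊗ P) u := hom_counit hC hB hQ.

Lemma incl2_forms : mul P ∘ ((i ⊗ i) ∘ jM) = zerom (dom jM) P.
Proof.
rewrite (compA hC), <- (proj2 base_mul), <- (compA hC) by hom.
rewrite (kernel_comp hC hjM hmM). now apply (comp0r hC).
Qed.

Lemma forms_inclP : Hom (dom jM) W (forms_incl P jP jM) /\
  jP ∘ forms_incl P jP jM = (i ⊗ i) ∘ jM.
Proof. apply (kernel_factor hC hjP (hom_mul hPa)); [hom|apply incl2_forms]. Qed.

(** Associativity moves the product of [P] onto [jP], which it kills. *)
Lemma forms_lactP : Hom (P ⊗ W) W (forms_lact P jP) /\
  jP ∘ forms_lact P jP = (mul P ⊗ idm P) ∘ (idm P ⊗ jP).
Proof.
apply (kernel_factor hC hjP (hom_mul hPa)); [hom|].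
rewrite (compA hC), (mul_assoc hPa), <- (compA hC), (tensE hC), mul_jP by hom.
ids. rewrite (tens0r hC W P (hom_idE hC P)).
apply (comp0r hC); hom.
Qed.

Lemma forms_ractP : Hom (W ⊗ P) W (forms_ract P jP) /\
  jP ∘ forms_ract P jP = (idm P ⊗ mul P) ∘ (jP ⊗ idm P).
Proof.
apply (kernel_factor hC hjP (hom_mul hPa)); [hom|].
rewrite (compA hC), <- (mul_assoc hPa), <- (compA hC), (tensE hC), mul_jP by hom.
ids. rewrite (tens0l hC W P (hom_idE hC P)).
apply (comp0r hC); hom.
Qed.

Lemma diffP : Hom P W (diff P jP) /\ jP ∘ diff P jP = a2 - a1.
Proof.
apply (kernel_factor hC hjP (hom_mul hPa)); [hom|].
rewrite (compBr hC), (mul_onel hPa), (mul_oner hPa) by hom.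
apply (subrr hC). hom.
Qed.

Lemma coact_mul : (mul P ⊗ idm B) ∘ tc = rho ∘ mul P.
Proof.
rewrite (alg_mul hrhoa). unfold tens_coact. cbn [mul braided_tensor].
rewrite !(compA hC) by hom. do 2 f_equal.
ids. rewrite (tensE hC) by hom. now ids.
Qed.

(** The coaction intertwines the products, by [coact_mul], and [jP ⊗ id] is still a kernel. *)
Lemma forms_coactP : Hom W (W ⊗ B) (forms_coact B P jP) /\
  (jP ⊗ idm B) ∘ forms_coact B P jP = tc ∘ jP.
Proof.
assert (h := tens_eqr (ba_compatible hC) B hjP).
destruct (factorP (e := jP ⊗ idm B) (f := tc ∘ jP)) as [h1 h2].
- apply (equaliser_lift h).
  + hom.
  + rewrite (hom_dom (hom_mul hPa)), (hom_cod (hom_mul hPa)).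
    rewrite (tens0l hC _ _ (hom_idE hC B)).
    rewrite (compA hC), coact_mul, <- (compA hC), mul_jP by hom.
    rewrite (comp0r hC W hrho'). symmetry. apply (comp0l hC). hom.
- split; [|exact h2].
  eapply hom_eq; [exact h1|hom|hom].
Qed.

Let hlact := proj1 forms_lactP.
Let hract := proj1 forms_ractP.
Let hdiff := proj1 diffP.
Let hfincl := proj1 forms_inclP.
Let hfcoact := proj1 forms_coactP.

Lemma hom_convl f al : Hom B P f -> Hom B W al -> Hom B W (convl B P jP f al).
Proof. intros; unfold convl, conv; hom. Qed.

Lemma hom_convr f al : Hom B P f -> Hom B W al -> Hom B W (convr B P jP al f).
Proof. intros; unfold convr, conv; hom. Qed.

Lemma convl_incl f al : Hom B P f -> Hom B W al ->
  jP ∘ convl B P jP f al = (a1 ∘ f) *[Q] (jP ∘ al).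
Proof.
intros hf hal. unfold convl, conv at 1.
rewrite !(compA hC), (proj2 forms_lactP) by hom.
rewrite <- (compA hC (f := f ⊗ al)), (tensE hC) by hom. ids.
symmetry. apply (pconv_inl hC hPa hPa (B := B) (V := B)); hom.
Qed.

Lemma convr_incl f al : Hom B P f -> Hom B W al ->
  jP ∘ convr B P jP al f = (jP ∘ al) *[Q] (a2 ∘ f).
Proof.
intros hf hal. unfold convr, conv at 1.
rewrite !(compA hC), (proj2 forms_ractP) by hom.
rewrite <- (compA hC (f := al ⊗ f)), (tensE hC) by hom. ids.
symmetry. apply (pconv_inr hC hPa hPa (B := B) (V := B)); hom.
Qed.
#[local] Hint Resolve hom_convl hom_convr : hom.

Lemma diff_triv : jP ∘ (diff P jP ∘ phi) = a2 ∘ phi - a1 ∘ phi.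
Proof. now rewrite (compA hC), (proj2 diffP), (compBl hC) by hom. Qed.

Lemma omega_of_incl A : Hom B (dom jM) A ->
  Hom B W (omega_of B P jP jM A) /\
  jP ∘ omega_of B P jP jM A + u =
    (a1 ∘ phi') *[Q] ((i ⊗ i) ∘ jM ∘ A + u) *[Q] (a2 ∘ phi).
Proof.
intros hA. unfold omega_of. split.
{ eapply (hom_addE hC); try reflexivity.
  - apply hom_convl; hom.
  - apply hom_convr; try hom. apply hom_convl; hom. }
assert (h1 : Hom B W (convl B P jP phi' (forms_incl P jP jM ∘ A)))
  by (apply hom_convl; hom).
assert (h2 : Hom B W (convr B P jP (convl B P jP phi' (forms_incl P jP jM ∘ A)) phi))
  by now apply hom_convr.
assert (h3 : Hom B W (convl B P jP phi' (diff P jP ∘ phi)))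
  by (apply hom_convl; hom).
rewrite (compDr hC) by hom.
rewrite convr_incl, !convl_incl, diff_triv by hom.
rewrite (compA hC), (proj2 forms_inclP) by hom.
rewrite (convBr hC hB hQ) by hom.
rewrite (convDr hC hB hQ), (convDl hC hB hQ), (conv1r hC hB hQ) by hom.
(* Both factors of this [Φ⁻¹ * Φ] lie in the first leg, so it collapses to [u], with a minus sign
   from [dΦ]; the added [u] cancels it. *)
rewrite <- (conv_post hC hB hPa hQ ha1) by hom.
rewrite (proj2 hphiV). fold (counit B P). rewrite (counit_post hC hB hPa hQ ha1).
rewrite (addC hC), (addA hC) by hom.
rewrite (addC hC (f := u)), (subrK hC) by hom.
apply (addC hC). hom.
Qed.

Lemma gauge_expr_incl om : Hom B W om ->
  Hom B W (gauge_expr B P jP om) /\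
  jP ∘ gauge_expr B P jP om + u =
    (a1 ∘ phi) *[Q] (jP ∘ om + u) *[Q] (a2 ∘ phi').
Proof.
intros hom_. unfold gauge_expr.
assert (h1 : Hom B W (convl B P jP phi om)) by (apply hom_convl; hom).
assert (h2 : Hom B W (convr B P jP (convl B P jP phi om) phi')) by now apply hom_convr.
assert (h3 : Hom B W (convr B P jP (diff P jP ∘ phi) phi')) by (apply hom_convr; hom).
split; [hom|].
rewrite (compBr hC) by hom.
rewrite !convr_incl, !convl_incl, diff_triv by hom.
rewrite (convBl hC hB hQ (f := a2 ∘ phi)) by hom.
rewrite (convDr hC hB hQ), (convDl hC hB hQ), (conv1r hC hB hQ) by hom.
(* Here it is the second leg that collapses, since [dΦ] is multiplied on the right. *)
rewrite <- (conv_post hC hB hPa hQ ha2) by hom.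
rewrite (proj1 hphiV). fold (counit B P). rewrite (counit_post hC hB hPa hQ ha2).
set (x := (a1 ∘ phi) *[Q] (a2 ∘ phi')).
set (z := (a1 ∘ phi) *[Q] (jP ∘ om) *[Q] (a2 ∘ phi')).
assert (hx : Hom B (P ⊗ P) x) by (unfold x; hom).
assert (hz : Hom B (P ⊗ P) z) by (unfold z; hom).
transitivity (z - (u - x) + (u - x + x)).
- f_equal. rewrite (subrK hC); hom || reflexivity.
- now rewrite (addA hC), (subrK hC) by hom.
Qed.

Lemma hom_Ad : Hom B (B ⊗ B) (Ad B).
Proof. unfold Ad; hom. Qed.

Lemma coact_counit : tc ∘ u = inl Q B ∘ u.
Proof.
rewrite tens_coact_bracket, (bracket_counit hC hB hPa hE hc1 hc2).
symmetry. apply (counit_post hC hB hQ hE hinlE).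
Qed.

(** For [F = u] the product in [tens_Ad] is [S * id], the convolution unit. *)
Lemma counit_Ad : (u ⊗ idm B) ∘ Ad B = tc ∘ u.
Proof.
rewrite tens_Ad, coact_counit, (counit_post hC hB hQ hE hinlE), (conv1r hC hB hE) by hom.
apply (proj2 (anti_conv_inverse hE hinrE)).
Qed.

(** The shift [u] is itself covariant, and [jP ⊗ id] is a monomorphism. *)
Lemma covariantE om : Hom B W om ->
  forms_coact B P jP ∘ om = (om ⊗ idm B) ∘ Ad B <->
  tc ∘ (jP ∘ om + u) = ((jP ∘ om + u) ⊗ idm B) ∘ Ad B.
Proof.
intros hom_. assert (hAd := hom_Ad).
rewrite (compDr hC), (tensDl hC), (compDl hC), counit_Ad by hom.
replace (jP ∘ om ⊗ idm B) with ((jP ⊗ idm B) ∘ (om ⊗ idm B)).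
2:{ rewrite (tensE hC) by hom. now ids. }
rewrite (compA hC), <- (proj2 forms_coactP), <- !(compA hC) by hom.
split; intros e.
- now rewrite e.
- apply (addIr hC) in e; try hom.
  eapply (mono_eq (X := B)); [| | | |exact e].
  + apply (equaliser_mono hC (tens_eqr (ba_compatible hC) B hjP)).
  + hom.
  + hom.
  + hom.
Qed.

Lemma chi_inl : chi B P ∘ a1 = inl P B.
Proof. rewrite chi_bracket. apply bracket_inl; auto. Qed.

Lemma chi_inr : chi B P ∘ a2 = rho.
Proof. rewrite chi_bracket. apply bracket_inr; auto. Qed.

Let hchi : Hom (P ⊗ P) (P ⊗ B) (chi B P).
Proof. unfold chi; hom. Qed.

(** [chi] sends [d p] to [p₀ ⊗ p₁ - p ⊗ 1], and the second term is killed by [ω(1) = 0]. *)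
Lemma proj_diff om : Hom B W om -> om ∘ one B = zerom unitO W ->
  jP ∘ (proj B P jP om ∘ diff P jP) = a1 ⋆[Q] (jP ∘ om).
Proof.
intros hom_ e. unfold proj.
rewrite <- !(compA hC), (proj2 diffP), (compBr hC), chi_inl, chi_inr by hom.
rewrite (compA hC), (proj2 forms_lactP) by hom.
rewrite !(compBr hC) by hom.
assert (h : (idm P ⊗ om) ∘ inl P B = zerom P (P ⊗ W)).
{ unfold inl. rewrite (tensE hC), e by hom. ids.
  rewrite (tens0r hC _ _ (hom_idE hC P)). now rewrite (ob1r hC). }
assert (hl := hlact).
rewrite <- !(compA hC), h, !(compA hC) by hom.
rewrite (comp0r hC P (Y := (P ⊗ W)%ob) (Z := (P ⊗ P)%ob)) by hom.
rewrite <- (addrK hC (f := a1 ⋆[Q] (jP ∘ om)) (g := zerom P (P ⊗ P))) at 1 by hom.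
rewrite (addr0 hC) by hom. f_equal.
rewrite <- (compA hC (f := idm P ⊗ om)), (tensE hC) by hom. ids.
generalize (pconv_inl hC hPa hPa (B := B) (V := P) rho (f := idm P) (F := jP ∘ om)).
ids. intros e'. symmetry. apply e'; hom.
Qed.

Lemma gauge_cancel f f' g g' F : Hom B P f -> Hom B P f' -> Hom B P g -> Hom B P g' ->
    Hom B (P ⊗ P) F -> conv_inverse B P f f' -> conv_inverse B P g g' ->
  (a1 ∘ f) *[Q] ((a1 ∘ f') *[Q] F *[Q] (a2 ∘ g)) *[Q] (a2 ∘ g') = F.
Proof.
intros hf hf' hg hg' hF i1 i2.
apply (conv_inverse_post hC hB hPa hQ ha1 hf hf') in i1.
apply (conv_inverse_post hC hB hPa hQ ha2 hg hg') in i2.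
rewrite <- (convA hC hB hQ (f := a1 ∘ f')) by hom.
rewrite (convK hC hB hQ i1), (convKr hC hB hQ i2) by hom. reflexivity.
Qed.

(** The shift [u] contributes [p ⊗ 1] and so absorbs the negative term of [d p]; what remains is
    [1 ⊗ p]. *)
Lemma strong_part om : Hom B W om -> om ∘ one B = zerom unitO W ->
  jP ∘ ((idm W - proj B P jP om) ∘ diff P jP) + a1 ⋆[Q] (jP ∘ om + u) = a2.
Proof.
intros hom_ e.
assert (hp : Hom W W (proj B P jP om)) by (unfold proj; hom).
rewrite (compBl hC), (compBr hC), (proj_diff hom_ e) by hom. ids.
rewrite (proj2 diffP).
rewrite (pconvDr hC hrho hQ) by hom. rewrite (pconv_counit hC hB hrho hQ) by hom.
now rewrite (addA hC), !(subrK hC) by hom.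
Qed.

Lemma gauge_one F f g : Hom B (P ⊗ P) F -> Hom B P f -> Hom B P g ->
  f ∘ one B = one P -> g ∘ one B = one P ->
  ((a1 ∘ f) *[Q] F *[Q] (a2 ∘ g)) ∘ one B = F ∘ one B.
Proof.
intros hF hf hg ef eg.
rewrite (conv_one_r hC hB hQ), (conv_one_l hC hB hQ); try hom; try reflexivity.
- rewrite <- (compA hC), ef by hom. apply (alg_one ha1).
- rewrite <- (compA hC), eg by hom. apply (alg_one ha2).
Qed.

Lemma forms_incl_mono : mono (forms_incl P jP jM).
Proof.
intros X f g hf hg e.
rewrite (hom_dom hfincl) in hf, hg.
apply (mono_eq (equaliser_mono hC hjM) eq_refl hf hg).
eapply (mono_eq (X := X) incl2_mono); [hom|hom|hom|].
rewrite !(compA hC), <- !(proj2 forms_inclP), <- !(compA hC) by hom. now rewrite e.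
Qed.

Lemma add_counit_inj F G : Hom B (P ⊗ P) F -> Hom B (P ⊗ P) G -> F + u = G + u -> F = G.
Proof. intros hF hG. apply (addIr hC); hom. Qed.

(** * From gauge forms to strong connections *)

Section ToConnection.
Context (A : Mor C) (hA : Hom B (dom jM) A) (hA1 : A ∘ one B = zerom unitO (dom jM)).
Local Notation A' := ((i ⊗ i) ∘ jM ∘ A).
Local Notation om := (omega_of B P jP jM A).
Let hom_ : Hom B W om := proj1 (omega_of_incl hA).
Let hA' : Hom B (P ⊗ P) A'.
Proof. hom. Qed.

Lemma omega_of_chi : chi B P ∘ jP ∘ om = one P ⊗ (idm B - one B ∘ cou B).
Proof.
(* This is (C1) shifted by [chi ∘ u]. The form [A] drops out because [chi] kills it, leaving
   [Φ⁻¹ * Φ * id] in [R]. *)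
assert (e : chi B P ∘ (jP ∘ om + u) = inr P B).
{ rewrite (proj2 (omega_of_incl hA)). rewrite chi_bracket.
  rewrite (bracket_gauge hC hB hPa hR hinlB hrhoa) by hom.
  rewrite <- chi_bracket, (compDr hC), !(compA hC), chi_incl2 by hom.
    rewrite <- (compA hC (h := inl P B)), <- (compA hC (h := mul P)) by hom.
  rewrite incl2_forms, (comp0r hC _ (Y := P) (Z := (P ⊗ B)%ob)) by hom.
  rewrite (comp0l hC (Y := dom jM)), (add0r hC) by hom.
  rewrite chi_bracket, (bracket_counit hC hB hPa hR hinlB hrhoa), (conv1r hC hB hR) by hom.
  rewrite coact_triv.
  apply (convK hC hB hR); try hom.
  apply (conv_inverse_post hC hB hPa hR hinlB hphi' hphi (conv_inverseC hphiV)). }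
rewrite (compDr hC), (compA hC) in e by hom.
rewrite <- (compA hC) in * by hom.
apply (addIr hC (h := chi B P ∘ u)); try hom.
rewrite e. rewrite (tensBr hC (hom_one hPa)) by hom.
rewrite chi_bracket, (bracket_counit hC hB hPa hR hinlB hrhoa).
rewrite <- (counit_post hC hB hBa hR hinrB).
replace (inr P B ∘ counit B B) with (one P ⊗ (one B ∘ cou B)).
- unfold inr. rewrite (subrK hC) by hom. reflexivity.
- unfold inr, counit. rewrite <- (tens1l hC (one B ∘ cou B)) at 2.
  rewrite (tensE hC) by hom. now ids.
Qed.

Lemma omega_of_one : om ∘ one B = zerom unitO W.
Proof.
assert (e := f_equal (fun f => f ∘ one B) (proj2 (omega_of_incl hA))). cbn beta in e.
rewrite gauge_one in e; try hom; [|apply triv_inv_one|apply (triv_one hP)].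
rewrite !(compDl hC) in e by hom. apply (addIr hC) in e; try hom.
rewrite <- (compA hC (h := (i ⊗ i) ∘ jM)), hA1 in e by hom.
rewrite (comp0r hC unitO (Z := (P ⊗ P)%ob)) in e by hom.
eapply (mono_eq (X := unitO) hjmono); [hom|hom|hom|].
rewrite (compA hC), e by hom. symmetry. now apply (comp0r hC).
Qed.

Lemma omega_of_covariant : forms_coact B P jP ∘ om = (om ⊗ idm B) ∘ Ad B.
Proof.
apply (covariantE hom_). rewrite (proj2 (omega_of_incl hA)).
apply coact_gauge; [hom|].
rewrite !(compDr hC), coact_counit by hom. f_equal.
rewrite !(compA hC) by hom. now rewrite coact_incl2.
Qed.

Lemma base_form_lift : exists t, Hom P (dom jM) t /\ (i ⊗ i) ∘ jM ∘ t =
  a2 ∘ base_part - ((a1 ∘ base_part) ⋆[Q] A' + a1 ∘ base_part).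
Proof.
assert (hs := hom_base_part).
destruct (incl_lift hs coact_base_part) as [s [hs' es]].
(* With [s] the corestriction of [base_part], this is [d(s(p)) - s(p₀) A(p₁)], formed in [M ⊗ M]. *)
set (K := one (base P) ⊗ s -
  ((mul (base P) ⊗ idm M) ∘ (s ⊗ (jM ∘ A)) ∘ rho + s ⊗ one (base P))).
assert (hK : Hom P (M ⊗ M) K) by (unfold K; hom).
assert (h1 : (i ⊗ i) ∘ (one (base P) ⊗ s) = a2 ∘ base_part).
{ rewrite (tensE hC), (proj2 base_one), es by hom. unfold inr.
  rewrite <- (tens1l hC base_part) at 2. rewrite (tensE hC) by hom. now ids. }
assert (h2 : (i ⊗ i) ∘ (s ⊗ one (base P)) = a1 ∘ base_part).
{ rewrite (tensE hC), (proj2 base_one), es by hom. unfold inl.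
  rewrite <- (tens1r hC base_part) at 2. rewrite (tensE hC) by hom. now ids. }
assert (h3 : (a1 ∘ base_part) ⋆[Q] A' = (mul P ⊗ idm P) ∘ (base_part ⊗ A') ∘ rho).
{ apply (pconv_inl hC hPa hPa (B := B) (V := P)); hom. }
assert (h4 : (i ⊗ i) ∘ ((mul (base P) ⊗ idm M) ∘ (s ⊗ (jM ∘ A)) ∘ rho) =
  (a1 ∘ base_part) ⋆[Q] A').
{ rewrite h3, !(compA hC), (tensE hC (f' := i)) by hom. f_equal.
  rewrite (proj2 base_mul), <- es.
  replace ((mul P ∘ (i ⊗ i)) ⊗ (i ∘ idm M)) with ((mul P ⊗ idm P) ∘ (i ⊗ (i ⊗ i))).
  2:{ rewrite (tensA hC), (tensE hC) by hom. now ids. }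
  rewrite <- (compA hC), (tensE hC), (compA hC) by hom. reflexivity. }
assert (eK : (i ⊗ i) ∘ K =
  a2 ∘ base_part - ((a1 ∘ base_part) ⋆[Q] A' + a1 ∘ base_part)).
{ unfold K. now rewrite (compBr hC), (compDr hC), h1, h2, h4 by hom. }
destruct (kernel_lift hC (h := K) hjM hmM hK) as [t [ht et]].
(* The product of [K] is computed in [P]: the two terms of the differential cancel and [A] has
   product zero. *)
- eapply (mono_eq (X := P) incl_mono); [hom|hom|hom|].
  rewrite (compA hC), (proj2 base_mul), <- (compA hC), eK by hom.
  rewrite (comp0r hC P hi).
  rewrite (compBr hC), (compDr hC), h3, !(compA hC) by hom.
  assert (m1 : mul P ∘ a1 = idm P) by apply (mul_oner hPa).
  assert (m2 : mul P ∘ a2 = idm P) by apply (mul_onel hPa).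
  rewrite m1, m2, (mul_assoc hPa). ids.
  rewrite <- (compA hC (h := mul P)), (tensE hC), !(compA hC) by hom.
  rewrite <- (compA hC (h := mul P)), <- (compA hC (h := mul P)), incl2_forms by hom.
  rewrite (comp0l hC P hA). ids.
  rewrite (tens0r hC B P hs), (comp0l hC (P ⊗ P) hrho'), (comp0r hC P (hom_mul hPa)).
  rewrite (add0r hC hs). apply (subrr hC hs).
- exists t. split; [exact ht|].
  rewrite <- (compA hC), et by hom. exact eK.
Qed.

Lemma omega_of_strong : is_strong B P jP jM om.
Proof.
assert (hs := hom_base_part).
assert (e := strong_part hom_ omega_of_one).
destruct base_form_lift as [t [ht et]].
assert (hp : Hom W W (proj B P jP om)).
{ assert (hl := hlact). unfold proj; hom. }
assert (hsp : Hom (dom jM ⊗ P) W (right_span P jP jM)).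
{ assert (hr := hract). assert (hf := hfincl). unfold right_span; hom. }
(* The preimage in [Ω¹M ⊗ P] is [t(p₀) ⊗ Φ(p₁)]. *)
apply (factors_through_imageI hC (W := P) (t := (t ⊗ phi) ∘ rho) hsp); [hom|].
eapply (mono_eq (X := P) hjmono); [hom|hom|hom|].
(* After adding [p₀ ω'(p₁)] the left side is [1 ⊗ p]. On the right, [p₀ Φ⁻¹(p₁)] regroups into
   [base_part], the terms in [A] cancel, and [base_part_triv] restores [p]. *)
apply (addIr hC (h := a1 ⋆[Q] (jP ∘ om + u))); try hom.
rewrite e, (proj2 (omega_of_incl hA)).
rewrite <- !(pconv_assoc hC hB hrho hQ) by hom.
rewrite <- (comp1r hC (f := a1) (X := P)) at 1 by hom.
rewrite <- (pconv_post hC hrho hPa hQ ha1) by hom. fold base_part.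
rewrite (pconvDr hC hrho hQ), (pconv_counit hC hB hrho hQ) by hom.
assert (e2 : jP ∘ (right_span P jP jM ∘ ((t ⊗ phi) ∘ rho)) =
   ((i ⊗ i) ∘ jM ∘ t) ⋆[Q] (a2 ∘ phi)).
{ assert (hr := hract). assert (hf := hfincl). unfold right_span.
  rewrite (pconv_inr hC hPa hPa (B := B) (V := P)) by hom.
  rewrite !(compA hC), (proj2 forms_ractP) by hom. f_equal.
  rewrite <- (compA hC (f := forms_incl P jP jM ⊗ idm P)), <- (compA hC (f := t ⊗ phi)) by hom.
  f_equal. rewrite !(tensE hC), (proj2 forms_inclP) by hom. now ids. }
rewrite e2, et.
rewrite <- (pconvDl hC hrho hQ), (subrK hC) by hom.
rewrite <- (pconv_post hC hrho hPa hQ ha2), base_part_triv by hom. now ids.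
Qed.

Lemma gauge_expr_omega_of : gauge_expr B P jP om = forms_incl P jP jM ∘ A.
Proof.
destruct (gauge_expr_incl hom_) as [h e].
eapply (mono_eq (X := B) hjmono); [hom|hom|hom|].
rewrite (compA hC), (proj2 forms_inclP) by hom.
apply add_counit_inj; try hom.
rewrite e, (proj2 (omega_of_incl hA)).
apply gauge_cancel; try exact hphiV; hom.
Qed.

End ToConnection.

(** * From strong connections to gauge forms *)

Section ToGauge.
Context (om : Mor C) (hom_ : Hom B W om).
Context (hone : om ∘ one B = zerom unitO W).
Context (hcov : forms_coact B P jP ∘ om = (om ⊗ idm B) ∘ Ad B).
Context (hstr : is_strong B P jP jM om).
Local Notation ge := (gauge_expr B P jP om).
Local Notation T := ((a1 ∘ phi) *[Q] (jP ∘ om + u) *[Q] (a2 ∘ phi')).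

Let hge : Hom B W ge := proj1 (gauge_expr_incl hom_).
Let geE : jP ∘ ge + u = T := proj2 (gauge_expr_incl hom_).

(** Right multiplication by [P] does not touch the first factor, which stays in [M]. *)
Lemma right_span_left_based :
  Hom (dom jM ⊗ P) W (right_span P jP jM) /\ left_based (jP ∘ right_span P jP jM).
Proof.
assert (hr := hract). assert (hf := hfincl).
split; [unfold right_span; hom|].
replace (jP ∘ right_span P jP jM) with ((idm P ⊗ mul P) ∘ (((i ⊗ i) ∘ jM) ⊗ idm P)).
- apply left_based_mulr with (dom jM) (acar P); try hom.
  apply left_based_comp with (dom jM) (M ⊗ M)%ob; try hom. apply left_based_incl2.
- unfold right_span. rewrite (compA hC), (proj2 forms_ractP) by hom.
  rewrite <- (compA hC (f := forms_incl P jP jM ⊗ idm P)) by hom.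
  rewrite (tensE hC (f' := jP)), (proj2 forms_inclP) by hom. now ids.
Qed.

Let hp : Hom W W (proj B P jP om).
Proof. assert (hl := hlact). unfold proj; hom. Qed.

Lemma strong_left_based : left_based (jP ∘ ((idm W - proj B P jP om) ∘ diff P jP)).
Proof.
destruct right_span_left_based as [hsp e]. unfold left_based in *.
rewrite !(compA hC (h := _ ⊗ _)) in * by hom.
eapply (subr0_eq hC (X := P)); [hom|hom|].
rewrite <- (compBl hC) by hom.
(* Being left based means being killed by one difference of morphisms; that difference kills
   [right_span], hence everything that factors through its image. *)
apply (image_annihilated hC hstr hsp (W := P)); [hom|hom|].
rewrite (compBl hC), e by hom. apply (subrr hC). hom.
Qed.

Lemma pconv_triv F : Hom B (P ⊗ P) F ->
  (a1 ⋆[Q] F) ∘ phi = (a1 ∘ phi) *[Q] F.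
Proof.
intros hF. unfold pconv, conv.
rewrite <- !(compA hC), (triv_coact hP), !(compA hC) by hom. f_equal.
rewrite <- (compA hC), (tensE hC) by hom. now ids.
Qed.

(** In [strong_part] the total [1 ⊗ p] and the strong term are left based, hence so is [p₀ ω'(p₁)].
    Composing with [Φ] gives [Φ * ω'], and right multiplication by [Φ⁻¹] preserves the property. *)
Lemma left_based_total : left_based T.
Proof.
assert (e := strong_part hom_ hone).
set (f := jP ∘ ((idm W - proj B P jP om) ∘ diff P jP)) in e.
assert (hf : Hom P (P ⊗ P) f) by (unfold f; hom).
assert (lf : left_based f) by exact strong_left_based.
assert (lF : left_based ((a1 ∘ phi) *[Q] (jP ∘ om + u))).
{ rewrite <- pconv_triv by hom. apply left_based_comp with (acar B) (acar P); try hom.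
  unfold left_based.
  assert (e1 := f_equal (fun h => (rho ⊗ idm P) ∘ h) e).
  assert (e2 := f_equal (fun h => (inl P B ⊗ idm P) ∘ h) e).
  cbn beta in e1, e2. rewrite left_based_inr in e1. rewrite <- e2 in e1.
  rewrite !(compDr hC), lf in e1 by hom.
  rewrite !(addC hC (f := (inl P B ⊗ idm P) ∘ f)) in e1 by hom.
  eapply (addIr hC); [| |exact e1]; hom. }
assert (h := pconv_inr hC hPa hPa (B := B) (V := B) (cop B)
   (F := (a1 ∘ phi) *[Q] (jP ∘ om + u)) (g := phi')).
unfold pconv in h. unfold conv at 1. rewrite h by hom.
apply left_based_comp with (acar B) (B ⊗ B)%ob; try hom.
apply left_based_mulr with (acar B) (acar B); hom || exact lF.
Qed.

Lemma gauge_expr_lift : exists A, Hom B (dom jM) A /\ forms_incl P jP jM ∘ A = ge.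
Proof.
assert (c : tc ∘ T = inl Q B ∘ T).
{ apply coact_gauge_inv; [hom|]. now apply (covariantE hom_). }
destruct (incl2_lift (X := B) (F := T)) as [G [hG eG]];
  [hom|exact left_based_total|exact c|].
(* [G] lifts the shifted form [A + u]; the subtracted term is the lift of [u] to [M ⊗ M]. *)
set (G0 := G - (one (base P) ⊗ one (base P)) ∘ cou B).
assert (hG0 : Hom B (M ⊗ M) G0) by (unfold G0; hom).
assert (eG0 : (i ⊗ i) ∘ G0 = jP ∘ ge).
{ apply add_counit_inj; try hom. rewrite geE. unfold G0.
  rewrite (compBr hC), eG, (compA hC), (tensE hC), (proj2 base_one) by hom.
  change (counit B Q) with ((one P ⊗ one P) ∘ cou B). rewrite (subrK hC) by hom. reflexivity. }
destruct (kernel_lift hC (h := G0) hjM hmM hG0) as [A [hA eA]].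
- eapply (mono_eq (X := B) incl_mono); [hom|hom|hom|].
  rewrite (compA hC), (proj2 base_mul), <- (compA hC), eG0, (compA hC), mul_jP by hom.
  rewrite (comp0r hC B hi). now apply (comp0l hC).
- exists A. split; [exact hA|].
  assert (hf := hfincl).
  eapply (mono_eq (X := B) hjmono); [hom|hom|hom|].
  rewrite (compA hC), (proj2 forms_inclP), <- (compA hC), eA by hom. exact eG0.
Qed.

Lemma gauge_ofP : Hom B (dom jM) (gauge_of B P jP jM om) /\
  forms_incl P jP jM ∘ gauge_of B P jP jM om = ge.
Proof.
destruct gauge_expr_lift as [A [hA eA]]. unfold gauge_of.
destruct (factorP (e := forms_incl P jP jM) (f := ge)) as [h e].
- exists A. split; [|exact eA]. eapply hom_eq; [exact hA|symmetry; hom|symmetry; hom].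
- split; [|exact e]. eapply hom_eq; [exact h|hom|].
  rewrite (hom_dom hfincl). reflexivity.
Qed.

Let hga : Hom B (dom jM) (gauge_of B P jP jM om) := proj1 gauge_ofP.

Lemma gauge_of_one : gauge_of B P jP jM om ∘ one B = zerom unitO (dom jM).
Proof.
assert (hf := hfincl).
eapply (mono_eq (X := unitO) forms_incl_mono); [hom|hom|hom|].
rewrite (compA hC), (proj2 gauge_ofP), (comp0r hC unitO hf) by hom.
eapply (mono_eq (X := unitO) hjmono); [hom|hom|hom|].
apply (addIr hC (h := u ∘ one B)); try hom.
rewrite (compA hC), <- (compDl hC), geE by hom.
rewrite gauge_one; try hom; [|apply (triv_one hP)|apply triv_inv_one].
rewrite (compDl hC), <- (compA hC), hone by hom. reflexivity.
Qed.

Lemma omega_of_gauge_of : omega_of B P jP jM (gauge_of B P jP jM om) = om.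
Proof.
destruct (omega_of_incl hga) as [h e].
eapply (mono_eq (X := B) hjmono); [hom|hom|hom|].
apply add_counit_inj; try hom.
assert (hf := hfincl).
rewrite e, <- (proj2 forms_inclP), <- (compA hC), (proj2 gauge_ofP), geE by hom.
apply gauge_cancel; try exact (conv_inverseC hphiV); hom.
Qed.

End ToGauge.

(** [A] witnesses the factorisation, and [forms_incl] being a monomorphism forces the chosen one to
    agree with it. *)
Lemma gauge_of_omega_of A : Hom B (dom jM) A ->
  gauge_of B P jP jM (omega_of B P jP jM A) = A.
Proof.
intros hA. unfold gauge_of. rewrite (gauge_expr_omega_of hA).
assert (hf := hfincl).
destruct (factorP (e := forms_incl P jP jM) (f := forms_incl P jP jM ∘ A)) as [h e].
- exists A. split; [|reflexivity]. eapply hom_eq; [exact hA|symmetry; hom|symmetry; hom].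
- eapply (mono_eq (X := B) forms_incl_mono); [hom| |hom|exact e].
  eapply hom_eq; [exact h|hom|hom].
Qed.

End Forms.
End Bundle.

(** The correspondence is stated as two maps with both composites the identity. As [gauge_of] is
    defined by choice, the clause on [forms_incl] certifies that it corestricts the stated
    formula. *)
Theorem proposition3p3 (C : cat_data) (hC : is_braided_abelian C)
  (B : bgroup C) (hB : is_braided_group B)
  (P : tbundle C) (hP : is_trivial_bundle B P)
  (jP : Mor C) (hjP : is_kernel jP (mul P))
  (jM : Mor C) (hjM : is_kernel jM (mul (base P))) :
  (forall A : Mor C, is_gauge_form B jM A ->
     is_strong_connection B P jP jM (omega_of B P jP jM A) /\
     gauge_of B P jP jM (omega_of B P jP jM A) = A)
  /\
  (forall omega : Mor C, is_strong_connection B P jP jM omega ->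
     is_gauge_form B jM (gauge_of B P jP jM omega) /\
     forms_incl P jP jM ∘ gauge_of B P jP jM omega = gauge_expr B P jP omega /\
     omega_of B P jP jM (gauge_of B P jP jM omega) = omega).
Proof.
split.
- intros A [hA hA1]. split; [split; [split|]|].
  + apply (omega_of_incl hC hB hP hjP hjM hA).
  + now apply omega_of_chi.
  + now apply omega_of_one.
  + now apply omega_of_covariant.
  + now apply omega_of_strong.
  + now apply gauge_of_omega_of.
- intros om [[hom_ _ hone hcov] hstr]. split; [split|split].
  + now apply gauge_ofP.
  + now apply gauge_of_one.
  + now apply gauge_ofP.
  + now apply omega_of_gauge_of.
Qed.
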